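(* Let $R$ be a commutative ring with $1$ equipped with an involution $r\mapsto\overline{r}$ (possibly the identity), and let $G$ and $H$ be Hausdorff ample groupoids. Then there is a $*$-isomorphism (an $R$-algebra isomorphism commuting with the involutions) $$\sigma: A_R(G)\otimes_R A_R(H)\to A_R(G\times H)$$ such that $\sigma\big(D_R(G)\otimes D_R(H)\big)=D_R(G\times H)$, where $D_R(G)\otimes D_R(H)$ denotes the $R$-submodule of $A_R(G)\otimes_R A_R(H)$ spanned by the tensors $d\otimes d'$ with $d\in D_R(G)$, $d'\in D_R(H)$.
   Context: A groupoid $G$ is a small category with all morphisms invertible; its unit space is $G^{(0)}=\{x^{-1}x\mid x\in G\}$, source $s(x)=x^{-1}x$, range $r(x)=xx^{-1}$, and $(x,y)$ is composable iff $s(x)=r(y)$; $G_u=s^{-1}(u)$. A topological groupoid has continuous multiplication and inversion. An ample groupoid is a topological groupoid $G$ such that $s$ is a local homeomorphism and $G^{(0)}$ is locally compact, totally disconnected and Hausdorff. A compact open bisection is a compact open $B\subseteq G$ on which $s$ and $r$ are injective; $\operatorname{Bis}_c(G)$ is the set of these, and $\operatorname{Bis}_c(G^{(0)})$ is the set of compact open subsets of $G^{(0)}$. The product groupoid $G\times H$ has coordinatewise structure maps, unit space $G^{(0)}\times H^{(0)}$, and the product topology; it is again ample. Steinberg algebra: $A_R(G)$ is the $R$-submodule of $R^G$ (functions $G\to R$) spanned by the characteristic functions $\mathbf{1}_B$, $B\in\operatorname{Bis}_c(G)$, with convolution product $f*g(x)=\sum_{y\in G_{s(x)}}f(xy^{-1})g(y)$.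 The diagonal subalgebra $D_R(G)$ is the subalgebra generated by $\{\mathbf{1}_U\mid U\in\operatorname{Bis}_c(G^{(0)})\}$. The involution on $A_R(G)$ is $f^*(x)=\overline{f(x^{-1})}$. For $*$-algebras $A,B$ over $R$, $A\otimes_R B$ is a $*$-algebra with $(\sum a_i\otimes b_i)^*=\sum a_i^*\otimes b_i^*$. Algebras need not be unital. *)

(* Defs.v *)
From HB Require Import structures.
From mathcomp Require Import all_boot all_order all_algebra.
From mathcomp Require Import all_classical topology numfun.

Set Implicit Arguments.
Unset Strict Implicit.
Unset Printing Implicit Defensive.

Import GRing.Theory.

Local Open Scope classical_set_scope.
Local Open Scope ring_scope.
Local Open Scope quotient_scope.

(* A groupoid is given by its set of arrows, the objects being identified with
   the identity arrows. [gmul] is total, but only its values on composable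
   pairs, i.e. pairs (x, y) with gsrc x = grng y, are meaningful. *)
HB.mixin Record isGroupoid G := {
  gmul : G -> G -> G;
  ginv : G -> G;
  gsrc : G -> G;
  grng : G -> G;
  gmulVx : forall x, gmul (ginv x) x = gsrc x;
  gmulxV : forall x, gmul x (ginv x) = grng x;
  gsrcV : forall x, gsrc (ginv x) = grng x;
  grngV : forall x, grng (ginv x) = gsrc x;
  gsrcM : forall x y, gsrc x = grng y -> gsrc (gmul x y) = gsrc y;
  grngM : forall x y, gsrc x = grng y -> grng (gmul x y) = grng x;
  gmulA : forall x y z, gsrc x = grng y -> gsrc y = grng z ->
    gmul x (gmul y z) = gmul (gmul x y) z;
  gmul_src : forall x, gmul x (gsrc x) = x;
  gmul_rng : forall x, gmul (grng x) x = x
}.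

#[short(type="groupoidType")]
HB.structure Definition Groupoid := {G of isGroupoid G & Choice G}.

Section GroupoidTheory.
Variable G : groupoidType.
Implicit Types x y z : G.

Definition gunits : set G := range gsrc.

Definition gcomposable : set (G * G) := [set p | gsrc p.1 = grng p.2].

Lemma gsrc_units x : gsrc x \in gunits. Proof. by rewrite inE; exists x. Qed.

(* The source as a map into G^(0), which carries the subspace topology. *)
Definition gsrc0 x : gunits := exist _ (gsrc x) (gsrc_units x).

Lemma gsrcK x : gsrc (gsrc x) = gsrc x.
Proof. by rewrite -{1}(gmulVx x) gsrcM ?gsrcV. Qed.

Lemma grng_src x : grng (gsrc x) = gsrc x.
Proof. by rewrite -{1}(gmulVx x) grngM ?gsrcV ?grngV. Qed.

Lemma gsrc_rng x : gsrc (grng x) = grng x.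
Proof. by rewrite -(gsrcV x) gsrcK. Qed.

Lemma grngK x : grng (grng x) = grng x.
Proof. by rewrite -(gsrcV x) grng_src. Qed.

Lemma gmulVKx x y : gsrc x = grng y -> gmul (ginv x) (gmul x y) = y.
Proof. by move=> xy; rewrite gmulA ?gsrcV// gmulVx xy gmul_rng. Qed.

Lemma gmulKV x y : gsrc x = grng y -> gmul (gmul x y) (ginv y) = x.
Proof. by move=> xy; rewrite -gmulA ?grngV// gmulxV -xy gmul_src. Qed.

Lemma gmulVK x y : gsrc x = gsrc y -> gmul (gmul x (ginv y)) y = x.
Proof.
by move=> xy; rewrite -gmulA ?gsrcV ?grngV ?grngV// gmulVx -xy gmul_src.
Qed.

Lemma ginvK : involutive (@ginv G).
Proof.
move=> x; rewrite -{2}[x](@gmulVKx (ginv x) x) ?gsrcV//.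
by rewrite gmulVx -grngV -[in RHS]gsrcV gmul_src.
Qed.

Lemma ginvM x y : gsrc x = grng y -> ginv (gmul x y) = gmul (ginv y) (ginv x).
Proof.
move=> xy; have c1 : gsrc (ginv y) = grng (ginv x) by rewrite gsrcV grngV.
have c2 : gsrc (gmul x y) = grng (ginv y) by rewrite gsrcM// grngV.
rewrite -[RHS](@gmulVKx (gmul x y)); last by rewrite grngM.
rewrite [X in _ = gmul _ X]gmulA// gmulKV// gmulxV -(grngM _ _ xy) -gsrcV.
by rewrite gmul_src.
Qed.

Lemma gunitsP u : gunits u -> [/\ gsrc u = u, grng u = u & ginv u = u].
Proof.
move=> [x _ <-]; split; rewrite ?gsrcK ?grng_src//.
by rewrite -gmulVx ginvM ?gsrcV// ginvK gmulVx.
Qed.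

End GroupoidTheory.

HB.mixin Record isTopologicalGroupoid G of Groupoid G & Topological G := {
  continuous_ginv : continuous (@ginv G);
  continuous_gmul :
    {within @gcomposable G, continuous (fun p : G * G => gmul p.1 p.2)}
}.

#[short(type="topologicalGroupoidType")]
HB.structure Definition TopologicalGroupoid :=
  {G of isTopologicalGroupoid G & Groupoid G & Topological G}.

(* Around every point, f restricts to a homeomorphism, with inverse g, from an
   open set U onto an open set. *)
Definition local_homeomorphism {X Y : topologicalType} (f : X -> Y) :=
  forall x, exists (U : set X) (g : Y -> X),
    [/\ open U, U x & open (f @` U)] /\
    [/\ {within U, continuous f}, {within f @` U, continuous g} &
        {in U, cancel f g}].

HB.mixin Record isAmple G of TopologicalGroupoid G := {
  local_homeomorphism_gsrc : local_homeomorphism (@gsrc0 G);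
  locally_compact_gunits : locally_compact [set: @gunits G];
  totally_disconnected_gunits : totally_disconnected [set: @gunits G];
  hausdorff_gunits : hausdorff_space (@gunits G)
}.

#[short(type="ampleGroupoidType")]
HB.structure Definition AmpleGroupoid :=
  {G of isAmple G & TopologicalGroupoid G}.

Section LocalHomeomorphism.
Variables X Y : topologicalType.
Implicit Type f : X -> Y.

Lemma local_homeomorphismP f : local_homeomorphism f <->
  continuous f /\ forall x, exists U : set X, [/\ open U, U x,
    {in U &, injective f} &
    forall W, open W -> W `<=` U -> open (f @` W)].
Proof.
split=> [lhf|[cf hf] x].
  split=> [x|x].
    have [U [g [[oU Ux _] []]]] := lhf x.
    rewrite continuous_open_subspace// => cf _ _.
    by apply: cf; rewrite inE.
  have [U [g [[oU Ux ofU] [cf cg fK]]]] := lhf x.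
  exists U; split=> //; first by move=> a b aU bU e; rewrite -(fK a)// e fK.
  move=> W oW WU.
  have -> : f @` W = (f @` U) `&` g @^-1` W.
    rewrite eqEsubset; split=> [_ [w Ww <-]|_ [[u Uu <-]]] /=.
      by split; [exists w => //; exact: WU|rewrite fK// inE; exact: WU].
    by rewrite fK ?inE// => Wu; exists u.
  move: cg; rewrite continuous_open_subspace// => cg.
  rewrite openE => y [fUy Wgy]; apply: filterI; first exact: open_nbhs_nbhs.
  by apply: (cg y); [rewrite inE|exact: open_nbhs_nbhs].
have [U [oU Ux fI fo]] := hf x.
pose g y := if pselect (exists2 u, U u & f u = y) is left P
            then s2val (cid2 P) else x.
have fK : {in U, cancel f g}.
  move=> u; rewrite inE => Uu; rewrite /g; case: pselect => [P|[]]; last first.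
    by exists u.
  by case: cid2 => /= v Uv /fI; apply; rewrite inE.
have ofU : open (f @` U) by exact: fo.
exists U, g; split=> //; split=> //; first exact: continuous_subspaceT.
rewrite continuous_open_subspace// => _ /set_mem [u Uu <-] B /=.
rewrite fK ?inE// nbhsE => -[C [oC Cu] CB].
change (nbhs (f u) (g @^-1` B)); rewrite nbhsE.
exists (f @` (C `&` U)); first last.
  by move=> _ [c [Cc Uc] <-] /=; rewrite fK ?inE//; exact: CB.
by split; [apply: fo => //; exact: openI|exists u].
Qed.

End LocalHomeomorphism.

Section TopologicalGroupoidTheory.
Variable G : topologicalGroupoidType.

Lemma nbhs_gmul (x y : G) (B : set G) : gsrc x = grng y ->
  nbhs (gmul x y) B -> exists P Q : set G, [/\ nbhs x P, nbhs y Q &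
    forall a b, P a -> Q b -> gsrc a = grng b -> B (gmul a b)].
Proof.
move=> xy Bxy;
have /subspace_continuousP/(_ (x, y) xy B Bxy) := @continuous_gmul G.
rewrite /= => -[[P Q] [/= Px Qy] PQ]; exists P, Q; split=> // a b Pa Qb ab.
by apply: (PQ (a, b)).
Qed.

End TopologicalGroupoidTheory.

Section InitialTopology.

Lemma continuous_set_val {X : topologicalType} (A : set X) :
  continuous (set_val : A -> X).
Proof. exact: initial_continuous. Qed.

Lemma continuous_into_set {X Y : topologicalType} (A : set Y) (f : X -> A) :
  continuous (set_val \o f) -> continuous f.
Proof. by move=> cf; apply: continuous_comp_initial. Qed.

Lemma continuous_pair {X Y Z : topologicalType} (f : X -> Y) (g : X -> Z) :
  continuous f -> continuous g -> continuous (fun x => (f x, g x)).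
Proof. by move=> cf cg x; apply: cvg_pair; [exact: cf|exact: cg]. Qed.

Lemma continuous_hausdorff {X : topologicalType} :
  (forall p q : X, (forall (Y : topologicalType) (f : X -> Y),
     hausdorff_space Y -> continuous f -> f p = f q) -> p = q) ->
  hausdorff_space X.
Proof.
move=> sep p q pq; apply: sep => Y f hY cf; apply: hY => A B Ap Bq.
by have [x [Ax Bx]] := pq _ _ (cf p A Ap) (cf q B Bq); exists (f x).
Qed.

End InitialTopology.

Section ProductGroupoid.
Variables G H : groupoidType.
Local Notation GH := (G * H)%type.

Definition prod_gmul (p q : GH) : GH := (gmul p.1 q.1, gmul p.2 q.2).
Definition prod_ginv (p : GH) : GH := (ginv p.1, ginv p.2).
Definition prod_gsrc (p : GH) : GH := (gsrc p.1, gsrc p.2).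
Definition prod_grng (p : GH) : GH := (grng p.1, grng p.2).

Let mulVx p : prod_gmul (prod_ginv p) p = prod_gsrc p.
Proof. by rewrite /prod_gmul/= !gmulVx. Qed.

Let mulxV p : prod_gmul p (prod_ginv p) = prod_grng p.
Proof. by rewrite /prod_gmul/= !gmulxV. Qed.

Let srcV p : prod_gsrc (prod_ginv p) = prod_grng p.
Proof. by rewrite /prod_gsrc/= !gsrcV. Qed.

Let rngV p : prod_grng (prod_ginv p) = prod_gsrc p.
Proof. by rewrite /prod_grng/= !grngV. Qed.

Let srcM p q : prod_gsrc p = prod_grng q ->
  prod_gsrc (prod_gmul p q) = prod_gsrc q.
Proof. by case=> h1 h2; rewrite /prod_gsrc/= !gsrcM. Qed.

Let rngM p q : prod_gsrc p = prod_grng q ->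
  prod_grng (prod_gmul p q) = prod_grng p.
Proof. by case=> h1 h2; rewrite /prod_grng/= !grngM. Qed.

Let mulA p q r : prod_gsrc p = prod_grng q -> prod_gsrc q = prod_grng r ->
  prod_gmul p (prod_gmul q r) = prod_gmul (prod_gmul p q) r.
Proof. by case=> h1 h2 [h3 h4]; rewrite /prod_gmul/= !gmulA. Qed.

Let mul_src p : prod_gmul p (prod_gsrc p) = p.
Proof. by case: p => x y; rewrite /prod_gmul/= !gmul_src. Qed.

Let mul_rng p : prod_gmul (prod_grng p) p = p.
Proof. by case: p => x y; rewrite /prod_gmul/= !gmul_rng. Qed.

HB.instance Definition _ := isGroupoid.Build GH
  mulVx mulxV srcV rngV srcM rngM mulA mul_src mul_rng.

Lemma gunits_prod : @gunits GH = @gunits G `*` @gunits H.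
Proof.
rewrite eqEsubset; split=> [_ [p _ <-]|[_ _] [/= [x _ <-] [y _ <-]]].
  by split; [exists p.1|exists p.2].
by exists (x, y).
Qed.

Lemma gunits_prodP (p : GH) : gunits p -> gunits p.1 /\ gunits p.2.
Proof. by rewrite gunits_prod. Qed.

End ProductGroupoid.

Section ProductTopologicalGroupoid.
Variables G H : topologicalGroupoidType.
Local Notation GH := (G * H)%type.

Let cinv : continuous (@ginv GH).
Proof.
apply: (@continuous_pair GH G H) => p.
  exact: (continuous_comp (@cvg_fst _ _ _ _ _) (@continuous_ginv G _)).
exact: (continuous_comp (@cvg_snd _ _ _ _ _) (@continuous_ginv H _)).
Qed.

Let cmul :
  {within @gcomposable GH, continuous (fun p : GH * GH => gmul p.1 p.2)}.
Proof.
apply/subspace_continuousP => -[[x y] [x' y']] [/= xx' yy'] B.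
move=> [[B1 B2] /= [B1x B2y] BB].
have [P1 [Q1 [P1x Q1x PQ1]]] := nbhs_gmul xx' B1x.
have [P2 [Q2 [P2y Q2y PQ2]]] := nbhs_gmul yy' B2y.
exists (P1 `*` P2, Q1 `*` Q2) => /=.
  by split; [exists (P1, P2)|exists (Q1, Q2)].
move=> [[a b] [a' b']] [/= [/= P1a P2b] [/= Q1a Q2b]] [/= aa' bb'].
by apply: BB; split; [exact: PQ1|exact: PQ2].
Qed.

HB.instance Definition _ := isTopologicalGroupoid.Build GH cinv cmul.

End ProductTopologicalGroupoid.

Section ProductAmple.
Variables G H : ampleGroupoidType.
Local Notation GH := (G * H)%type.

Let fwd1_subproof (u : @gunits GH) : (set_val u).1 \in @gunits G.
Proof.
exact/mem_set/(gunits_prodP (set_mem (valP u))).1.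
Qed.

Let fwd2_subproof (u : @gunits GH) : (set_val u).2 \in @gunits H.
Proof.
exact/mem_set/(gunits_prodP (set_mem (valP u))).2.
Qed.

Let fwd1 (u : @gunits GH) : @gunits G :=
  exist (fun x => x \in @gunits G) _ (fwd1_subproof u).
Let fwd2 (u : @gunits GH) : @gunits H :=
  exist (fun x => x \in @gunits H) _ (fwd2_subproof u).
Let fwd u := (fwd1 u, fwd2 u).

Let bwd_subproof (p : @gunits G * @gunits H) :
  (set_val p.1, set_val p.2) \in @gunits GH.
Proof.
by case: p => -[x ux] [y uy]; rewrite inE gunits_prod; split; exact: set_mem.
Qed.

Let bwd p : @gunits GH :=
  exist (fun x => x \in @gunits GH) _ (bwd_subproof p).

Let fwdK : cancel fwd bwd.
Proof. by move=> [[x y] u]; exact: eq_sig_hprop. Qed.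

Let bwdK : cancel bwd fwd.
Proof. by move=> [[x ux] [y uy]]; congr (_, _); exact: eq_sig_hprop. Qed.

Let cfwd1 : continuous fwd1.
Proof.
apply: continuous_into_set => u.
exact: (continuous_comp (@continuous_set_val _ _ _) (@cvg_fst _ _ _ _ _)).
Qed.

Let cfwd2 : continuous fwd2.
Proof.
apply: continuous_into_set => u.
exact: (continuous_comp (@continuous_set_val _ _ _) (@cvg_snd _ _ _ _ _)).
Qed.

Let cfwd : continuous fwd. Proof. exact: continuous_pair. Qed.

Let cbwd : continuous bwd.
Proof.
apply: continuous_into_set; apply: (@continuous_pair _ G H) => p.
  exact: (continuous_comp (@cvg_fst _ _ _ _ _) (@continuous_set_val _ _ _)).
exact: (continuous_comp (@cvg_snd _ _ _ _ _) (@continuous_set_val _ _ _)).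
Qed.

Let hausdorff : hausdorff_space (@gunits GH).
Proof.
apply: continuous_hausdorff => p q sep.
rewrite -(fwdK p) -(fwdK q) /fwd; congr (bwd (_, _)).
  by apply: sep => //; exact: hausdorff_gunits.
by apply: sep => //; exact: hausdorff_gunits.
Qed.

Let bwd_image (B : set (@gunits G * @gunits H)) : bwd @` B = fwd @^-1` B.
Proof.
rewrite eqEsubset; split=> [_ [p Bp <-]|u Bu]; first by rewrite /= bwdK.
by exists (fwd u).
Qed.

Let lcompact : locally_compact [set: @gunits GH].
Proof.
move=> u _.
have [B1 nB1 [cB1 clB1]] := @locally_compact_gunits G (fwd1 u) I.
have [B2 nB2 [cB2 clB2]] := @locally_compact_gunits H (fwd2 u) I.
have nT (X : topologicalType) (x : X) B :
    within [set: X] (nbhs x) B <-> nbhs x B.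
  rewrite /within/=.
  by split; apply: (@filterS X (nbhs x)) => y; [exact|move=> ? _].
exists (bwd @` (B1 `*` B2)).
  apply/nT; rewrite bwd_image; apply: cfwd.
  by exists (B1, B2) => //; split; exact/nT.
have cB : compact (bwd @` (B1 `*` B2)).
  apply: continuous_compact; last exact: compact_setX.
  exact: continuous_subspaceT.
by split=> //; exact: compact_closed.
Qed.

Let tdisconnected : totally_disconnected [set: @gunits GH].
Proof.
move=> u _; rewrite eqEsubset; split=> [v [C [Cu _ conC] Cv]|_ ->]; last first.
  exact: connected_component_refl.
rewrite /= -(fwdK v) -(fwdK u) /fwd; congr (bwd (_, _)).
  have : connected_component [set: @gunits G] (fwd1 u) (fwd1 v).
    exists (fwd1 @` C); last by exists v.
    split=> //.
    apply: connected_continuous_connected => //; exact: continuous_subspaceT.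
  by rewrite totally_disconnected_gunits.
have : connected_component [set: @gunits H] (fwd2 u) (fwd2 v).
  exists (fwd2 @` C); last by exists v.
  split=> //.
  apply: connected_continuous_connected => //; exact: continuous_subspaceT.
by rewrite totally_disconnected_gunits.
Qed.

Let lhomeo : local_homeomorphism (@gsrc0 GH).
Proof.
have [cG hG] := (local_homeomorphismP _).1 (@local_homeomorphism_gsrc G).
have [cH hH] := (local_homeomorphismP _).1 (@local_homeomorphism_gsrc H).
have sE : @gsrc0 GH = bwd \o (fun p => (gsrc0 p.1, gsrc0 p.2)).
  by apply/funext => p; exact: eq_sig_hprop.
apply/local_homeomorphismP; split.
  rewrite sE => p; apply: continuous_comp; last exact: cbwd.
  apply: (@continuous_pair GH) => q.
    exact: (continuous_comp (@cvg_fst _ _ _ _ _) (cG _)).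
  exact: (continuous_comp (@cvg_snd _ _ _ _ _) (cH _)).
move=> [x y]; have [U [oU Ux Ui Uo]] := hG x; have [V [oV Vy Vi Vo]] := hH y.
exists (U `*` V); split=> //.
- rewrite openE => -[a b] [/= Ua Vb]; exists (U, V) => //.
  by split; exact: open_nbhs_nbhs.
- move=> [a b] [a' b']; rewrite !inE => -[/= Ua Vb] [/= Ua' Vb'].
  move=> /(congr1 set_val) [/= ea eb]; congr (_, _).
    by apply: Ui; rewrite ?inE//; exact: eq_sig_hprop.
  by apply: Vi; rewrite ?inE//; exact: eq_sig_hprop.
- move=> W oW WUV; rewrite sE -image_comp bwd_image.
  move: cfwd => /continuousP; apply.
  rewrite openE => _ [[a b] Wab <-] /=.
  have [[P Q] /= [Pa Qb] PQ] : nbhs (a, b) W by exact: open_nbhs_nbhs.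
  have [Ua Vb] := WUV _ Wab.
  move: Pa; rewrite nbhsE => -[P' [oP' P'a] P'P].
  move: Qb; rewrite nbhsE => -[Q' [oQ' Q'b] Q'Q].
  exists (@gsrc0 G @` (P' `&` U), @gsrc0 H @` (Q' `&` V)).
    split; apply: open_nbhs_nbhs; split.
    + by apply: Uo => //; exact: openI.
    + by exists a.
    + by apply: Vo => //; exact: openI.
    + by exists b.
  move=> [_ _] [/= [a' [P'a' _] <-] [b' [Q'b' _] <-]].
  by exists (a', b') => //; apply: PQ; split; [exact: P'P|exact: Q'Q].
Qed.

HB.instance Definition _ :=
  isAmple.Build GH lhomeo lcompact tdisconnected hausdorff.

End ProductAmple.

(* The zero ring is not excluded; conjr 1 = 1 follows from the axioms. *)
HB.mixin Record ComPzRing_hasInvolution R of GRing.ComPzRing R := {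
  conjr : R -> R;
  conjrD : {morph conjr : x y / x + y};
  conjrM : {morph conjr : x y / x * y};
  conjrK : involutive conjr
}.

#[short(type="involutiveRingType")]
HB.structure Definition InvolutiveRing :=
  {R of ComPzRing_hasInvolution R & GRing.ComPzRing R}.

Lemma conjr1 (R : involutiveRingType) : conjr 1 = 1 :> R.
Proof. by rewrite -[LHS]mulr1 -{2}[1](@conjrK R) -conjrM mul1r conjrK. Qed.

Lemma conjr0 (R : involutiveRingType) : conjr 0 = 0 :> R.
Proof. by apply: (@addrI _ (conjr 0)); rewrite -conjrD !addr0. Qed.

HB.mixin Record Lmodule_isNonUnitalAlgebra (R : comPzRingType) A
    of GRing.Lmodule R A := {
  amul : A -> A -> A;
  amulA : associative amul;
  amulDl : left_distributive amul +%R;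
  amulDr : right_distributive amul +%R;
  amulZl : forall (k : R) x y, amul (k *: x) y = k *: amul x y;
  amulZr : forall (k : R) x y, amul x (k *: y) = k *: amul x y
}.

#[short(type="nonUnitalAlgType")]
HB.structure Definition NonUnitalAlgebra (R : comPzRingType) :=
  {A of Lmodule_isNonUnitalAlgebra R A & GRing.Lmodule R A}.

HB.mixin Record NonUnitalAlgebra_isStar (R : involutiveRingType) A
    of NonUnitalAlgebra R A := {
  star : A -> A;
  starD : {morph star : x y / x + y};
  starZ : forall (k : R) x, star (k *: x) = conjr k *: star x;
  starM : forall x y, star (amul x y) = amul (star y) (star x);
  starK : involutive star
}.

#[short(type="starAlgType")]
HB.structure Definition StarAlgebra (R : involutiveRingType) :=
  {A of NonUnitalAlgebra_isStar R A & NonUnitalAlgebra R A}.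

Definition star_isomorphism (R : involutiveRingType) (A B : starAlgType R)
    (f : A -> B) :=
  [/\ linear f, {morph f : x y / amul x y}, {morph f : x / star x} &
      bijective f].

Section Span.
Variables (R : pzRingType) (V : lmodType R).
Implicit Types (X : set V) (v : V).

Definition lspan X : set V := [set v | exists s : seq (R * V),
  (forall p, p \in s -> X p.2) /\ v = \sum_(p <- s) p.1 *: p.2].

Lemma lspan0 X : lspan X 0.
Proof. by exists [::]; rewrite big_nil; split. Qed.

Lemma sub_lspan X : X `<=` lspan X.
Proof.
move=> v Xv; exists [:: (1, v)]; rewrite big_seq1 scale1r; split=> // p.
by rewrite inE => /eqP->.
Qed.

Lemma lspanD X u v : lspan X u -> lspan X v -> lspan X (u + v).
Proof.
move=> [s [Xs ->]] [t [Xt ->]]; exists (s ++ t); rewrite big_cat; split=> // p.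
by rewrite mem_cat => /orP[/Xs|/Xt].
Qed.

Lemma lspanZ X k v : lspan X v -> lspan X (k *: v).
Proof.
move=> [s [Xs ->]]; exists [seq (k * p.1, p.2) | p <- s]; split.
  by move=> _ /mapP[p /Xs Xp ->].
by rewrite big_map scaler_sumr; apply: eq_bigr => p _; rewrite /= scalerA.
Qed.

Lemma lspan_ind X (P : V -> Prop) : P 0 ->
  (forall k x v, X x -> P v -> P (k *: x + v)) -> forall v, lspan X v -> P v.
Proof.
move=> P0 PD _ [s [Xs ->]];
elim: s Xs => [|p s IHs] Xs; first by rewrite big_nil.
rewrite big_cons; apply: PD; first by apply: Xs; rewrite mem_head.
by apply: IHs => q qs; apply: Xs; rewrite inE qs orbT.
Qed.

End Span.

Section Subalgebra.
Variables (R : comPzRingType) (A : nonUnitalAlgType R).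

Definition subalgebra (S : set A) :=
  [/\ S 0, forall x y, S x -> S y -> S (x + y),
      forall (k : R) x, S x -> S (k *: x) &
      forall x y, S x -> S y -> S (amul x y)].

Definition generated_subalgebra (X : set A) : set A := smallest subalgebra X.

End Subalgebra.

Section TensorRelation.
Variables (R : comPzRingType) (A B : lmodType R).

(* Two formal sums a1 (x) b1 + ... + an (x) bn of pairs are identified if this
   follows from bilinearity. The opposite of a (x) b is (- a) (x) b. *)
Inductive tensor_eq : seq (A * B) -> seq (A * B) -> Prop :=
| tensor_eq_refl s : tensor_eq s s
| tensor_eq_sym s t : tensor_eq s t -> tensor_eq t s
| tensor_eq_trans s t u : tensor_eq s t -> tensor_eq t u -> tensor_eq s u
| tensor_eq_cat s s' t t' :
    tensor_eq s s' -> tensor_eq t t' -> tensor_eq (s ++ t) (s' ++ t')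
| tensor_eq_catC s t : tensor_eq (s ++ t) (t ++ s)
| tensor_eq_0 b : tensor_eq [:: (0, b)] [::]
| tensor_eq_Dl a a' b : tensor_eq [:: (a + a', b)] [:: (a, b); (a', b)]
| tensor_eq_Dr a b b' : tensor_eq [:: (a, b + b')] [:: (a, b); (a, b')]
| tensor_eq_Z (k : R) a b : tensor_eq [:: (k *: a, b)] [:: (a, k *: b)].

Definition tensor_rel s t := `[< tensor_eq s t >].

Lemma tensor_rel_refl : reflexive tensor_rel.
Proof. by move=> s; apply/asboolP/tensor_eq_refl. Qed.

Lemma tensor_rel_sym : symmetric tensor_rel.
Proof. by move=> s t; apply/asboolP/asboolP; exact: tensor_eq_sym. Qed.

Lemma tensor_rel_trans : transitive tensor_rel.
Proof.
by move=> t s u /asboolP st /asboolP tu; apply/asboolP/(tensor_eq_trans st).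
Qed.

Definition tensor_equiv :=
  EquivRel tensor_rel tensor_rel_refl tensor_rel_sym tensor_rel_trans.

Definition tensor : Type := {eq_quot tensor_equiv}.
HB.instance Definition _ := Choice.on tensor.

Definition tsum (s : seq (A * B)) : tensor := \pi_({eq_quot tensor_equiv}) s.

Definition tens (a : A) (b : B) : tensor := tsum [:: (a, b)].

Definition trepr (t : tensor) : seq (A * B) :=
  repr (t : {eq_quot tensor_equiv}).

Lemma treprK : cancel trepr tsum. Proof. exact: reprK. Qed.

Lemma tsum_eq s t : tensor_eq s t -> tsum s = tsum t.
Proof. by move=> st; apply/eqquotP/asboolP. Qed.

Lemma trepr_tsum s : tensor_eq (trepr (tsum s)) s.
Proof.
by apply/asboolP; have /eqquotP := treprK (tsum s).
Qed.

Definition tadd (x y : tensor) := tsum (trepr x ++ trepr y).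
Definition topp (x : tensor) := tsum [seq (- p.1, p.2) | p <- trepr x].
Definition tscale (k : R) (x : tensor) :=
  tsum [seq (k *: p.1, p.2) | p <- trepr x].

Lemma tensor_eq_map (f : A -> A) s t :
  f 0 = 0 -> {morph f : x y / x + y} -> {morph f : x / - x} ->
  (forall k, {morph f : x / k *: x}) ->
  tensor_eq s t ->
  tensor_eq [seq (f p.1, p.2) | p <- s] [seq (f p.1, p.2) | p <- t].
Proof.
move=> f0 fD fN fZ; elim=> {s t}; rewrite ?map_cat.
- by move=> s; exact: tensor_eq_refl.
- by move=> s t _ ?; exact: tensor_eq_sym.
- by move=> s t u _ st _; exact: tensor_eq_trans.
- by move=> s s' t t' _ ? _ ?; rewrite !map_cat; exact: tensor_eq_cat.
- by move=> s t; rewrite !map_cat; exact: tensor_eq_catC.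
- by move=> b /=; rewrite f0; exact: tensor_eq_0.
- by move=> a a' b /=; rewrite fD; exact: tensor_eq_Dl.
- by move=> a b b' /=; exact: tensor_eq_Dr.
- by move=> k a b /=; rewrite fZ; exact: tensor_eq_Z.
Qed.

Lemma taddE s t : tadd (tsum s) (tsum t) = tsum (s ++ t).
Proof. by apply/tsum_eq/tensor_eq_cat; exact: trepr_tsum. Qed.

Lemma toppE s : topp (tsum s) = tsum [seq (- p.1, p.2) | p <- s].
Proof.
apply/tsum_eq; apply: (@tensor_eq_map -%R); last exact: trepr_tsum.
- exact: oppr0.
- exact: opprD.
- by [].
- by move=> k a; rewrite scalerN.
Qed.

Lemma tscaleE k s : tscale k (tsum s) = tsum [seq (k *: p.1, p.2) | p <- s].
Proof.
apply/tsum_eq; apply: (@tensor_eq_map ( *:%R k)); last exact: trepr_tsum.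
- exact: scaler0.
- exact: scalerDr.
- exact: scalerN.
- by move=> l a; rewrite !scalerA mulrC.
Qed.

Lemma taddA : associative tadd.
Proof.
by move=> x y z; rewrite -[x]treprK -[y]treprK -[z]treprK !taddE catA.
Qed.

Lemma taddC : commutative tadd.
Proof.
move=> x y; rewrite -[x]treprK -[y]treprK !taddE.
exact/tsum_eq/tensor_eq_catC.
Qed.

Lemma tadd0 : left_id (tsum [::]) tadd.
Proof. by move=> x; rewrite -[x]treprK taddE. Qed.

Lemma taddN : left_inverse (tsum [::]) topp tadd.
Proof.
have tsumS p s : tsum (p :: s) = tadd (tsum [:: p]) (tsum s) by rewrite taddE.
move=> x; rewrite -[x]treprK toppE.
elim: (trepr x) => [|[a b] s IHs]; first by rewrite taddE.
rewrite /= tsumS [in X in tadd _ X]tsumS -taddA [X in tadd _ X]taddC -taddA.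
rewrite [X in tadd _ (tadd _ X)]taddC IHs [X in tadd _ X]taddC tadd0 taddE.
apply: tsum_eq; apply: tensor_eq_trans (tensor_eq_sym (tensor_eq_Dl _ _ _)) _.
by rewrite addNr; exact: tensor_eq_0.
Qed.

HB.instance Definition _ :=
  GRing.isZmodule.Build tensor taddA taddC tadd0 taddN.

Lemma tscaleA k l x : tscale k (tscale l x) = tscale (k * l) x.
Proof.
rewrite -[x]treprK !tscaleE -map_comp; congr tsum; apply: eq_map => p /=.
by rewrite scalerA.
Qed.

Lemma tscale1 : left_id 1 tscale.
Proof.
move=> x; rewrite -[x]treprK tscaleE -[in RHS](map_id (trepr x)); congr tsum.
by apply: eq_map => -[a b] /=; rewrite scale1r.
Qed.

Lemma tscaleDr : right_distributive tscale +%R.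
Proof.
move=> k x y; rewrite -[x]treprK -[y]treprK [X in tscale k X]taddE !tscaleE.
by rewrite [RHS]taddE map_cat.
Qed.

Lemma tsum_cons a b s : tsum ((a, b) :: s) = tens a b + tsum s.
Proof. by rewrite [RHS]taddE. Qed.

Lemma tsumE s : tsum s = \sum_(p <- s) tens p.1 p.2.
Proof.
elim: s => [|[a b] s IHs]; first by rewrite big_nil.
by rewrite big_cons tsum_cons IHs.
Qed.

Lemma tensDl b : {morph tens^~ b : a a' / a + a'}.
Proof. by move=> a a'; rewrite [RHS]taddE; exact/tsum_eq/tensor_eq_Dl. Qed.

Lemma tensDr a : {morph tens a : b b' / b + b'}.
Proof. by move=> b b'; rewrite [RHS]taddE; exact/tsum_eq/tensor_eq_Dr. Qed.

Lemma tscaleDl x : {morph tscale^~ x : k l / k + l}.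
Proof.
move=> k l; rewrite /= -[x]treprK !tscaleE !tsumE !big_map -big_split /=.
by apply: eq_bigr => p _; rewrite scalerDl tensDl.
Qed.

HB.instance Definition _ := GRing.Zmodule_isLmodule.Build R tensor
  tscaleA tscale1 tscaleDr tscaleDl.

Lemma tensZl k a b : tens (k *: a) b = k *: tens a b.
Proof. by rewrite [RHS]tscaleE. Qed.

Lemma tensZr k a b : tens a (k *: b) = k *: tens a b.
Proof. by rewrite -tensZl; exact/tsum_eq/tensor_eq_sym/tensor_eq_Z. Qed.

Lemma tensor_ind (P : tensor -> Prop) : P 0 ->
  (forall a b x, P x -> P (tens a b + x)) -> forall x, P x.
Proof.
move=> P0 PD x; rewrite -[x]treprK.
by elim: (trepr x) => [//|[a b] s IHs]; rewrite tsum_cons; exact: PD.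
Qed.

Section Lift.
Variables (M : zmodType) (f : A -> B -> M).

Definition balanced :=
  [/\ forall a a' b, f (a + a') b = f a b + f a' b,
      forall a b b', f a (b + b') = f a b + f a b' &
      forall (k : R) a b, f (k *: a) b = f a (k *: b)].

Definition tlift (x : tensor) : M := \sum_(p <- trepr x) f p.1 p.2.

Hypothesis f_bal : balanced.

Lemma tlift_tsum s : tlift (tsum s) = \sum_(p <- s) f p.1 p.2.
Proof.
have [fDl fDr fZ] := f_bal.
have f0 b : f 0 b = 0 by apply: (@addrI _ (f 0 b)); rewrite -fDl !addr0.
suff fE s' t : tensor_eq s' t ->
    \sum_(p <- s') f p.1 p.2 = \sum_(p <- t) f p.1 p.2.
  by rewrite /tlift; exact/fE/trepr_tsum.
elim=> {s s' t} //.
- by move=> s t u _ -> _ ->.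
- by move=> s s' t t' _ IH1 _ IH2; rewrite !big_cat /= IH1 IH2.
- by move=> s t; rewrite !big_cat /= addrC.
- by move=> b; rewrite big_seq1 big_nil f0.
- by move=> a a' b; rewrite !big_cons !big_nil /= fDl !addr0.
- by move=> a b b'; rewrite !big_cons !big_nil /= fDr !addr0.
- by move=> k a b; rewrite !big_seq1 /= fZ.
Qed.

Lemma tlift_tens a b : tlift (tens a b) = f a b.
Proof. by rewrite tlift_tsum big_seq1. Qed.

Lemma tlift0 : tlift 0 = 0.
Proof. by rewrite [0]/(tsum [::]) tlift_tsum big_nil. Qed.

Lemma tliftD : {morph tlift : x y / x + y}.
Proof.
move=> x y; rewrite -[x]treprK -[y]treprK [_ + _]taddE !tlift_tsum.
by rewrite big_cat.
Qed.

End Lift.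

Lemma tensor_universal (M : lmodType R) (f : A -> B -> M) :
  (forall b, linear (f^~ b)) -> (forall a, linear (f a)) ->
  exists2 g : {linear tensor -> M}, forall a b, g (tens a b) = f a b &
    forall h : {linear tensor -> M},
      (forall a b, h (tens a b) = f a b) -> h =1 g.
Proof.
move=> fl fr.
have f0 a : f a 0 = 0.
  have := fr a 1 0 0; rewrite !scale1r addr0 => /(congr1 (fun z => z - f a 0)).
  by rewrite addrK subrr.
have f0l b : f 0 b = 0.
  have := fl b 1 0 0; rewrite !scale1r addr0 => /(congr1 (fun z => z - f 0 b)).
  by rewrite addrK subrr.
have fZr k a b : f a (k *: b) = k *: f a b.
  by have := fr a k b 0; rewrite f0 !addr0.
have fZl k a b : f (k *: a) b = k *: f a b.
  by have := fl b k a 0; rewrite f0l !addr0.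
have bal : balanced f.
  split=> [a a' b|a b b'|k a b].
  - by have := fl b 1 a a'; rewrite !scale1r.
  - by have := fr a 1 b b'; rewrite !scale1r.
  - by rewrite fZl fZr.
have glin : linear (tlift f).
  move=> k x y; rewrite (tliftD bal); congr (_ + _).
  elim/tensor_ind: x => [|a b x IHx].
    by rewrite scaler0 (tlift0 bal) scaler0.
  rewrite scalerDr !(tliftD bal) scalerDr IHx -tensZl !(tlift_tens bal).
  by rewrite fZl.
pose g : {linear tensor -> M} := HB.pack (tlift f)
  (GRing.isLinear.Build R tensor M *:%R (tlift f) glin).
exists g => [a b|h hE x]; first exact: tlift_tens.
elim/tensor_ind: x => [|a b x IHx]; first by rewrite !linear0.
by rewrite !linearD IHx hE /= (tlift_tens bal).
Qed.

End TensorRelation.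

Arguments tens {R A B}.

Section TensorAlgebra.
Variables (R : comPzRingType) (A B : nonUnitalAlgType R).
Local Notation T := (tensor A B).

(* Characterized by tmul_tens and bilinearity. *)
Definition tmul (x y : T) : T :=
  tlift (fun a b => tlift (fun a' b' => tens (amul a a') (amul b b')) y) x.

Let bal2 (a : A) (b : B) :
  balanced (fun a' b' => tens (amul a a') (amul b b')).
Proof.
split=> [a' a'' b'|a' b' b''|k a' b'].
- by rewrite amulDr tensDl.
- by rewrite amulDr tensDr.
- by rewrite !amulZr tensZl tensZr.
Qed.

Let bal1 (y : T) :
  balanced (fun a b => tlift (fun a' b' => tens (amul a a') (amul b b')) y).
Proof.
split=> [a a' b|a b b'|k a b].
- elim/tensor_ind: y => [|c d y IHy]; rewrite ?tlift0 ?addr0// !tliftD// IHy.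
  by rewrite !tlift_tens// addrACA amulDl tensDl.
- elim/tensor_ind: y => [|c d y IHy]; rewrite ?tlift0 ?addr0// !tliftD// IHy.
  by rewrite !tlift_tens// addrACA amulDl tensDr.
- elim/tensor_ind: y => [|c d y IHy]; rewrite ?tlift0 ?addr0// !tliftD// IHy.
  by rewrite !tlift_tens// !amulZl tensZl tensZr.
Qed.

Lemma tmul_tens a b a' b' :
  tmul (tens a b) (tens a' b') = tens (amul a a') (amul b b').
Proof. by rewrite /tmul !tlift_tens. Qed.

Lemma tmulDl : left_distributive tmul +%R.
Proof. by move=> x x' y; rewrite /tmul tliftD. Qed.

Lemma tmul0l y : tmul 0 y = 0.
Proof. by rewrite /tmul tlift0. Qed.

Lemma tmul_tensl a b y :
  tmul (tens a b) y = tlift (fun a' b' => tens (amul a a') (amul b b')) y.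
Proof. by rewrite /tmul tlift_tens. Qed.

Lemma tmul0r x : tmul x 0 = 0.
Proof.
elim/tensor_ind: x => [|a b x IHx]; first exact: tmul0l.
by rewrite tmulDl IHx tmul_tensl tlift0// addr0.
Qed.

Lemma tmulDr : right_distributive tmul +%R.
Proof.
move=> x y y'; elim/tensor_ind: x => [|a b x IHx].
  by rewrite !tmul0l addr0.
by rewrite !tmulDl IHx !tmul_tensl tliftD// addrACA.
Qed.

Lemma tmulZl (k : R) x y : tmul (k *: x) y = k *: tmul x y.
Proof.
elim/tensor_ind: x => [|a b x IHx]; first by rewrite scaler0 tmul0l scaler0.
rewrite scalerDr !tmulDl IHx scalerDr; congr (_ + _).
rewrite -tensZl; elim/tensor_ind: y {IHx} => [|c d y IHy].
  by rewrite !tmul0r scaler0.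
by rewrite !tmulDr IHy scalerDr !tmul_tens amulZl tensZl.
Qed.

Lemma tmulZr (k : R) x y : tmul x (k *: y) = k *: tmul x y.
Proof.
elim/tensor_ind: y => [|a b y IHy]; first by rewrite scaler0 tmul0r scaler0.
rewrite scalerDr !tmulDr IHy scalerDr; congr (_ + _).
rewrite -tensZl; elim/tensor_ind: x {IHy} => [|c d x IHx].
  by rewrite !tmul0l scaler0.
by rewrite !tmulDl IHx scalerDr !tmul_tens amulZr tensZl.
Qed.

Lemma tmulA : associative tmul.
Proof.
move=> x y z; elim/tensor_ind: x => [|a b x IHx]; first by rewrite !tmul0l.
rewrite !tmulDl IHx; congr (_ + _).
elim/tensor_ind: y {IHx} => [|a' b' y IHy]; first by rewrite !(tmul0l, tmul0r).
rewrite !(tmulDl, tmulDr) IHy; congr (_ + _).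
elim/tensor_ind: z {IHy} => [|c d z IHz]; first by rewrite !tmul0r.
by rewrite !tmulDr IHz !tmul_tens !amulA.
Qed.

HB.instance Definition _ := Lmodule_isNonUnitalAlgebra.Build R T
  tmulA tmulDl tmulDr tmulZl tmulZr.

End TensorAlgebra.

Section TensorStar.
Variables (R : involutiveRingType) (A B : starAlgType R).
Local Notation T := (tensor A B).

(* Characterized by tstar_tens and additivity. *)
Definition tstar : T -> T := tlift (fun a b => tens (star a) (star b)).

Let bal : balanced (fun (a : A) (b : B) => tens (star a) (star b)).
Proof.
split=> [a a' b|a b b'|k a b].
- by rewrite starD tensDl.
- by rewrite starD tensDr.
- by rewrite !starZ tensZl tensZr.
Qed.

Lemma tstar_tens a b : tstar (tens a b) = tens (star a) (star b).
Proof. exact: tlift_tens. Qed.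

Lemma tstarD : {morph tstar : x y / x + y}.
Proof. exact: tliftD. Qed.

Lemma tstar0 : tstar 0 = 0.
Proof. exact: tlift0. Qed.

Lemma tstarZ (k : R) x : tstar (k *: x) = conjr k *: tstar x.
Proof.
elim/tensor_ind: x => [|a b x IHx]; first by rewrite scaler0 tstar0 scaler0.
by rewrite scalerDr !tstarD scalerDr IHx -tensZl !tstar_tens starZ tensZl.
Qed.

Lemma tstarM x y : tstar (amul x y) = amul (tstar y) (tstar x).
Proof.
elim/tensor_ind: x => [|a b x IHx].
  by rewrite tstar0 [amul 0 y]tmul0l [amul _ 0]tmul0r tstar0.
rewrite amulDl !tstarD amulDr IHx; congr (_ + _).
elim/tensor_ind: y {IHx} => [|c d y IHy].
  by rewrite tstar0 [amul _ 0]tmul0r [amul 0 _]tmul0l tstar0.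
rewrite amulDr !tstarD amulDl IHy; congr (_ + _).
by rewrite [amul _ _]tmul_tens !tstar_tens [RHS]tmul_tens !starM.
Qed.

Lemma tstarK : involutive tstar.
Proof.
move=> x; elim/tensor_ind: x => [|a b x IHx]; first by rewrite !tstar0.
by rewrite !tstarD IHx !tstar_tens !starK.
Qed.

HB.instance Definition _ := NonUnitalAlgebra_isStar.Build R T
  tstarD tstarZ tstarM tstarK.

End TensorStar.

Section Bisections.
Variable G : ampleGroupoidType.
Implicit Types B C : set G.

Definition compact_open_bisections : set (set G) :=
  [set B | [/\ compact B, open B, set_inj B gsrc & set_inj B grng]].

Definition gprod B C : set G :=
  [set gmul p.1 p.2 | p in (B `*` C) `&` @gcomposable G].

Lemma continuous_gsrc0 : continuous (@gsrc0 G).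
Proof. exact: ((local_homeomorphismP _).1 (@local_homeomorphism_gsrc G)).1. Qed.

Lemma continuous_gsrc : continuous (@gsrc G).
Proof.
move=> x; have cv := @continuous_set_val _ (@gunits G).
exact: (continuous_comp (@continuous_gsrc0 x) (cv _)).
Qed.

Lemma open_gsrc0 B : open B -> open (@gsrc0 G @` B).
Proof.
move=> oB; rewrite openE => _ [x Bx <-].
have [_ /(_ x) [U [oU Ux _ Uo]]] :=
  (local_homeomorphismP _).1 (@local_homeomorphism_gsrc G).
rewrite /interior nbhsE; exists (@gsrc0 G @` (B `&` U)).
  by split; [apply: Uo => //; exact: openI|exists x].
by move=> _ [y [By _] <-]; exists y.
Qed.

Lemma open_gunits : open (@gunits G).
Proof.
rewrite openE => u uu; have [su _ _] := gunitsP uu.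
have [_ /(_ u) [U [oU Ux Ui _]]] :=
  (local_homeomorphismP _).1 (@local_homeomorphism_gsrc G).
have : nbhs u (U `&` gsrc @^-1` U).
  apply: filterI; first exact: open_nbhs_nbhs.
  by apply: continuous_gsrc; apply: open_nbhs_nbhs; rewrite su.
rewrite /interior; apply: filterS => x [Ux' Usx].
exists (gsrc x) => //; rewrite gsrcK; apply: Ui; rewrite ?inE//.
by apply: eq_sig_hprop => //=; rewrite gsrcK.
Qed.

Lemma closed_gcomposable : closed (@gcomposable G).
Proof.
rewrite -openC openE => -[x y] /= xy.
have := @hausdorff_gunits G; rewrite open_hausdorff.
have : gsrc0 x != gsrc0 (ginv y).
  by apply/eqP => /(congr1 \val)/= e; apply: xy; rewrite /gcomposable/= e gsrcV.
move=> /[swap]/[apply] -[[U V] [/= xU yV] [oU oV UV]].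
move: xU yV; rewrite !inE => xU yV.
exists (@gsrc0 G @^-1` U, (@gsrc0 G \o @ginv G) @^-1` V).
  split => /=; first by apply: continuous_gsrc0; exact: open_nbhs_nbhs.
  apply: (continuous_comp (@continuous_ginv G y) (@continuous_gsrc0 _)).
  exact: open_nbhs_nbhs.
move=> [a b] [/= Ua Vb] ab; have : (U `&` V) (gsrc0 a).
  split=> //; have -> // : gsrc0 a = gsrc0 (ginv b).
  by apply: eq_sig_hprop => //=; rewrite gsrcV.
by move/eqP: UV => ->.
Qed.

Lemma compact_gprod B C : compact B -> compact C -> compact (gprod B C).
Proof.
move=> cB cC; apply: continuous_compact.
  exact: (continuous_subspaceW _ (@continuous_gmul G)).
apply: compact_closedI; first exact: compact_setX.
exact: closed_gcomposable.
Qed.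

Lemma open_gprod B C : open B -> open C -> open (gprod B C).
Proof.
move=> oB oC; rewrite openE => _ [[b c] [[/= Bb Cc] /= bc] <-].
have zc : gsrc (gmul b c) = grng (ginv c) by rewrite gsrcM// grngV.
have nB : nbhs (gmul (gmul b c) (ginv c)) B.
  by rewrite gmulKV//; exact: open_nbhs_nbhs.
have [P [Q [Pz Qc PQ]]] := nbhs_gmul zc nB.
have : nbhs c (C `&` @ginv G @^-1` Q).
  apply: filterI; first exact: open_nbhs_nbhs.
  exact: continuous_ginv.
rewrite nbhsE => -[D [oD Dc] DC].
have : nbhs (gmul b c) (P `&` @gsrc0 G @^-1` (@gsrc0 G @` D)).
  apply: filterI => //; apply: continuous_gsrc0; apply: open_nbhs_nbhs.
  split; first exact: open_gsrc0.
  by exists c => //; apply: eq_sig_hprop => //=; rewrite gsrcM.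
rewrite /interior; apply: filterS => z [Pz' [d Dd /(congr1 \val)/= dz]].
have [Cd Qd] := DC _ Dd.
exists (gmul z (ginv d), d); last by rewrite /= gmulVK.
split; first by split=> //=; apply: PQ => //; rewrite grngV.
by rewrite /gcomposable/= gsrcM ?gsrcV ?grngV.
Qed.

Lemma gprod_bisection B C : compact_open_bisections B ->
  compact_open_bisections C -> compact_open_bisections (gprod B C).
Proof.
move=> [cB oB siB riB] [cC oC siC riC]; split.
- exact: compact_gprod.
- exact: open_gprod.
- move=> x y /set_mem[[b c] [[/= Bb Cc] /= bc] <-].
  move=> /set_mem[[b' c'] [[/= Bb' Cc'] /= bc'] <-].
  rewrite !gsrcM// => /siC cc'; have {}cc' : c = c' by apply: cc'; rewrite inE.
  rewrite -cc' in bc' *; congr gmul; apply: siB; rewrite ?inE//.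
  by rewrite [LHS]bc -[LHS]bc'.
- move=> x y /set_mem[[b c] [[/= Bb Cc] /= bc] <-].
  move=> /set_mem[[b' c'] [[/= Bb' Cc'] /= bc'] <-].
  rewrite !grngM// => /riB bb'; have {}bb' : b = b' by apply: bb'; rewrite inE.
  rewrite -bb' in bc' *; congr gmul; apply: riC; rewrite ?inE//.
  by rewrite -[LHS]bc [LHS]bc'.
Qed.

Lemma ginv_image B : @ginv G @` B = @ginv G @^-1` B.
Proof.
rewrite eqEsubset; split=> [_ [x Bx <-]|x Bx]; first by rewrite /= ginvK.
by exists (ginv x) => //; rewrite ginvK.
Qed.

Lemma ginv_bisection B : compact_open_bisections B ->
  compact_open_bisections (@ginv G @^-1` B).
Proof.
move=> [cB oB siB riB]; split.
- rewrite -ginv_image; apply: continuous_compact => //.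
  by apply: continuous_subspaceT; exact: continuous_ginv.
- by move: (@continuous_ginv G) => /continuousP; apply.
- move=> x y /set_mem Bx /set_mem By; rewrite -!grngV => /riB e.
  by rewrite -[x]ginvK -[y]ginvK e ?inE.
- move=> x y /set_mem Bx /set_mem By; rewrite -!gsrcV => /siB e.
  by rewrite -[x]ginvK -[y]ginvK e ?inE.
Qed.

Lemma unit_bisection (U : set (@gunits G)) : open U -> compact U ->
  compact_open_bisections (set_val @` U).
Proof.
move=> oU cU; split.
- apply: continuous_compact => //; apply: continuous_subspaceT.
  exact: continuous_set_val.
- have [O oO <-] := oU; pose v := @set_val _ (@gunits G).
  have -> : v @` (v @^-1` O) = O `&` @gunits G.
    rewrite eqEsubset; split=> [_ [u Ou <-]|x [Ox ux]].
      by split=> //; exact: set_mem (valP u).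
    by exists (exist _ x (mem_set ux)).
  by apply: openI => //; exact: open_gunits.
- move=> x y /set_mem[u _ <-] /set_mem[v _ <-].
  have [-> _ _] := gunitsP (set_mem (valP u)).
  by have [-> _ _] := gunitsP (set_mem (valP v)).
- move=> x y /set_mem[u _ <-] /set_mem[v _ <-].
  have [_ -> _] := gunitsP (set_mem (valP u)).
  by have [_ -> _] := gunitsP (set_mem (valP v)).
Qed.

End Bisections.

Section Convolution.
Variables (R : comPzRingType) (G : ampleGroupoidType).
Implicit Types f g h : G -> R^o.

(* R^o is R as a module over itself: G -> R^o is the R-module R^G. *)
Definition steinberg_span : set (G -> R^o) :=
  lspan [set (\1_B : G -> R^o) | B in @compact_open_bisections G].

(* \sum_(y \in P) is 0 on infinite supports; by steinberg_fibre_finite,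
   this does not occur for g in the span of the indicators. *)
Definition convolution f g : G -> R^o := fun x =>
  \sum_(y \in [set y | gsrc y = gsrc x]) f (gmul x (ginv y)) * g y.

Lemma convolution_indic B C : compact_open_bisections C ->
  convolution \1_B \1_C = \1_(gprod B C) :> (G -> R^o).
Proof.
move=> [_ _ siC _]; apply/funext => x; rewrite /convolution.
have [[c Cc cx]|nC] := pselect (exists2 c, C c & gsrc c = gsrc x); last first.
  rewrite fsbig1 => [|y /= yx]; last first.
    by rewrite !indicE [y \in C]memNset ?mulr0// => Cy; apply: nC; exists y.
  rewrite indicE memNset// => -[[b c] [[_ /= Cc] /= bc] bcx].
  by apply: nC; exists c => //; rewrite -bcx gsrcM.
rewrite -(fsbig_widen [set c]) => [|_ -> //|y [/= yx yc]]; last first.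
  rewrite !indicE [y \in C]memNset ?mulr0// => Cy; apply: yc.
  by apply: siC; rewrite ?inE// cx.
rewrite fsbig_set1 !indicE (mem_set Cc) mulr1; congr (nat_of_bool _)%:R.
apply/idP/idP => [/set_mem Bxc|/set_mem[[b d] [[/= Bb Cd] /= bd] bdx]].
  rewrite inE; exists (gmul x (ginv c), c); last by rewrite /= gmulVK.
  by split=> //; rewrite /gcomposable/= gsrcM ?gsrcV ?grngV.
have -> : c = d by apply: siC; rewrite ?inE// cx -bdx gsrcM.
by rewrite inE -bdx gmulKV.
Qed.

Definition fibre_finite f := forall x,
  finite_set ([set y | gsrc y = gsrc x] `&` [set y | f y <> 0]).

Lemma fibre_finite_indic B : compact_open_bisections B ->
  fibre_finite (\1_B : G -> R^o).
Proof.
move=> [_ _ siB _] x.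
have [[b Bb bx]|nB] := pselect (exists2 b, B b & gsrc b = gsrc x).
  apply: (@sub_finite_set _ _ [set b]); last exact: finite_set1.
  move=> y [/= yx]; rewrite indicE;
  have [yB _|yB] := boolP (y \in B); last by [].
  by apply: siB; rewrite ?inE// ?bx//; exact: set_mem.
rewrite (_ : _ `&` _ = set0); first exact: finite_set0.
rewrite eqEsubset; split=> // y [/= yx]; rewrite indicE.
by have [/set_mem yB|] := boolP (y \in B); [case: nB; exists y|].
Qed.

Lemma fibre_finite_lin (k : R) f g :
  fibre_finite f -> fibre_finite g -> fibre_finite (k *: f + g).
Proof.
move=> Ff Fg x;
have: finite_set (([set y | gsrc y = gsrc x] `&` [set y | f y <> 0]) `|`
  ([set y | gsrc y = gsrc x] `&` [set y | g y <> 0])) by rewrite finite_setU.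
apply: sub_finite_set.
move=> y [/= yx kfg].
have [f0|f0] := eqVneq (f y) 0; last by left; split=> //=; exact/eqP.
right; split=> //=; apply: contra_not kfg => g0.
by rewrite /GRing.add/= /GRing.scale/= f0 g0 [_ *: _]mulr0 addr0.
Qed.

Lemma steinberg_fibre_finite f : steinberg_span f -> fibre_finite f.
Proof.
apply: lspan_ind => [x|k _ g [B Bb <-]]; last first.
  by apply: fibre_finite_lin; exact: fibre_finite_indic.
by rewrite (_ : _ `&` _ = set0) //; rewrite eqEsubset; split=> // y [_ /=].
Qed.

Lemma convolution_linr f (k : R) g h : fibre_finite g -> fibre_finite h ->
  convolution f (k *: g + h) = k *: convolution f g + convolution f h.
Proof.
move=> Fg Fh; apply/funext => x.
pose P := [set y | gsrc y = gsrc x]; pose F y := f (gmul x (ginv y)).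
change (\sum_(y \in P) F y * (k * g y + h y) =
  k * (\sum_(y \in P) F y * g y) + \sum_(y \in P) F y * h y).
pose D := (P `&` [set y | g y <> 0]) `|` (P `&` [set y | h y <> 0]).
have DP : D `<=` P by move=> y [[]|[]].
have fD : finite_set D by rewrite finite_setU; split; [exact: Fg|exact: Fh].
have D0 y : P y -> ~ D y -> g y = 0 /\ h y = 0.
  by move=> Py Dy; split; apply: contrapT => y0; apply: Dy; [left|right].
have sumD (e : G -> R) : (forall y, h y = 0 -> g y = 0 -> e y = 0) ->
    \sum_(y \in P) e y = \sum_(y \in D) e y.
  move=> e0; apply/esym/fsbig_widen => // y [Py /(D0 _ Py)[g0 h0]] /=.
  exact: e0.
rewrite !sumD; try by move=> y h0 g0; rewrite ?h0 ?g0 ?mulr0 ?addr0 ?mulr0.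
rewrite !fsbig_finite//= mulr_sumr -big_split/=.
apply: eq_bigr => y _.
by rewrite mulrDr mulrCA.
Qed.

Lemma convolution_linl (k : R) f g h : fibre_finite h ->
  convolution (k *: f + g) h = k *: convolution f h + convolution g h.
Proof.
move=> Fh; apply/funext => x.
pose P := [set y | gsrc y = gsrc x].
pose F y := f (gmul x (ginv y)); pose F' y := g (gmul x (ginv y)).
change (\sum_(y \in P) (k * F y + F' y) * h y =
  k * (\sum_(y \in P) F y * h y) + \sum_(y \in P) F' y * h y).
pose D := P `&` [set y | h y <> 0].
have DP : D `<=` P by move=> y [].
have fD : finite_set D by exact: Fh.
have D0 y : P y -> ~ D y -> h y = 0.
  by move=> Py Dy; apply: contrapT => y0; apply: Dy.
have sumD (e : G -> R) : (forall y, h y = 0 -> e y = 0) ->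
    \sum_(y \in P) e y = \sum_(y \in D) e y.
  by move=> e0; apply/esym/fsbig_widen => // y [Py /(D0 _ Py) h0]; exact: e0.
rewrite !sumD; try by move=> y ->; rewrite mulr0.
rewrite !fsbig_finite//= mulr_sumr -big_split/=.
apply: eq_bigr => y _.
by rewrite mulrDl mulrA.
Qed.

Lemma convolution0r f : convolution f 0 = 0.
Proof.
by apply/funext => x; rewrite /convolution fsbig1// => y _; rewrite mulr0.
Qed.

Lemma convolution0l f : convolution 0 f = 0.
Proof.
by apply/funext => x; rewrite /convolution fsbig1// => y _; rewrite mul0r.
Qed.

Lemma steinberg_span_indic B : compact_open_bisections B ->
  steinberg_span (\1_B : G -> R^o).
Proof. by move=> bB; apply: sub_lspan; exists B. Qed.

Lemma steinberg_span_lin (k : R) f g :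
  steinberg_span f -> steinberg_span g -> steinberg_span (k *: f + g).
Proof. by move=> sf sg; apply: lspanD => //; exact: lspanZ. Qed.

Lemma steinberg_span_ind (P : (G -> R^o) -> Prop) : P 0 ->
  (forall (k : R) B f, compact_open_bisections B -> steinberg_span f ->
     P f -> P (k *: (\1_B : G -> R^o) + f)) ->
  forall f, steinberg_span f -> P f.
Proof.
move=> P0 PD f sf; suff [] : steinberg_span f /\ P f by [].
move: f sf; apply: lspan_ind; first by split=> //; exact: lspan0.
move=> k _ f [B bB <-] [sf Pf]; split; last exact: PD.
by apply: steinberg_span_lin => //; exact: steinberg_span_indic.
Qed.

Lemma steinberg_span_convolution f g :
  steinberg_span f -> steinberg_span g -> steinberg_span (convolution f g).
Proof.
move=> sf sg; elim/steinberg_span_ind: sf => [|k B {}f bB sf IHf].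
  by rewrite convolution0l; exact: lspan0.
rewrite convolution_linl; last exact: steinberg_fibre_finite.
apply: steinberg_span_lin => // {IHf}.
elim/steinberg_span_ind: sg => [|l C {}g bC sg IHg].
  by rewrite convolution0r; exact: lspan0.
rewrite convolution_linr;
  [|exact: fibre_finite_indic|exact: steinberg_fibre_finite].
apply: steinberg_span_lin => //; rewrite convolution_indic//.
by apply: steinberg_span_indic; exact: gprod_bisection.
Qed.

End Convolution.

Section SteinbergAlgebra.
Variables (R : comPzRingType) (G : ampleGroupoidType).

Definition steinberg_pred : {pred G -> R^o} :=
  [pred f | `[< @steinberg_span R G f >]].

Let closed : submod_closed steinberg_pred.
Proof.
split=> [|k f g /asboolP sf /asboolP sg]; first exact/asboolP/lspan0.
exact/asboolP/steinberg_span_lin.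
Qed.

HB.instance Definition _ :=
  GRing.isSubmodClosed.Build R (G -> R^o) steinberg_pred closed.

Record steinberg := Steinberg {
  steinberg_fun :> G -> R^o;
  _ : steinberg_fun \in steinberg_pred
}.

HB.instance Definition _ := [isSub for steinberg_fun].
HB.instance Definition _ := [Choice of steinberg by <:].
HB.instance Definition _ := [SubChoice_isSubLmodule of steinberg by <:].

Implicit Types a b c : steinberg.

Lemma steinbergP a : steinberg_span (a : G -> R^o).
Proof. by case: a => f /= /asboolP. Qed.

Lemma steinberg_subproof f : steinberg_span f -> f \in steinberg_pred.
Proof. by move=> sf; apply/asboolP. Qed.

Definition sindic B (bB : compact_open_bisections B) : steinberg :=
  Steinberg (steinberg_subproof (steinberg_span_indic R bB)).

Lemma steinberg_ind (P : steinberg -> Prop) : P 0 ->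
  (forall k B (bB : compact_open_bisections B) a,
     P a -> P (k *: sindic bB + a)) ->
  forall a, P a.
Proof.
move=> P0 PD a.
have [b eab Pb] : exists2 b : steinberg, (b : G -> R^o) = a & P b.
  elim/steinberg_span_ind: (steinbergP a) => [|k B f bB _ [b bf Pb]].
    by exists 0.
  by exists (k *: sindic bB + b); [rewrite -bf|exact: PD].
by have -> : a = b by exact/val_inj.
Qed.

Definition smul a b : steinberg := Steinberg (steinberg_subproof
  (steinberg_span_convolution (steinbergP a) (steinbergP b))).

Lemma smul_lin_l k a b c : smul (k *: a + b) c = k *: smul a c + smul b c.
Proof.
by apply: val_inj; apply/convolution_linl/steinberg_fibre_finite/steinbergP.
Qed.

Lemma smul_lin_r k a b c : smul c (k *: a + b) = k *: smul c a + smul c b.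
Proof.
by apply: val_inj; apply: convolution_linr;
  exact/steinberg_fibre_finite/steinbergP.
Qed.

Lemma smul0l a : smul 0 a = 0.
Proof. by apply: val_inj; exact: convolution0l. Qed.

Lemma smul0r a : smul a 0 = 0.
Proof. by apply: val_inj; exact: convolution0r. Qed.

Lemma smulDl : left_distributive smul +%R.
Proof. by move=> a b c; have := smul_lin_l 1 a b c; rewrite !scale1r. Qed.

Lemma smulDr : right_distributive smul +%R.
Proof. by move=> a b c; have := smul_lin_r 1 b c a; rewrite !scale1r. Qed.

Lemma smulZl k a b : smul (k *: a) b = k *: smul a b.
Proof. by have := smul_lin_l k a 0 b; rewrite smul0l !addr0. Qed.

Lemma smulZr k a b : smul a (k *: b) = k *: smul a b.
Proof. by have := smul_lin_r k b 0 a; rewrite smul0r !addr0. Qed.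

Lemma smul_indic B C (bB : compact_open_bisections B)
    (bC : compact_open_bisections C) :
  smul (sindic bB) (sindic bC) = sindic (gprod_bisection bB bC).
Proof. by apply: val_inj; exact: convolution_indic. Qed.

Lemma gprodA (B C D : set G) : gprod B (gprod C D) = gprod (gprod B C) D.
Proof.
rewrite eqEsubset; split=> z.
  move=> [[b y] [[/= Bb [[c d] [[/= Cc Dd] /= cd] <-]]]].
  rewrite /gcomposable/= grngM// => bc <-; exists (gmul b c, d) => /=.
    by split; [split=> //; exists (b, c)|rewrite /gcomposable/= gsrcM].
  by rewrite gmulA.
move=> [[y d] [[/= [[b c] [[/= Bb Cc] /= bc] <-] Dd]]].
rewrite /gcomposable/= gsrcM// => cd <-; exists (b, gmul c d) => /=.
  by split; [split=> //; exists (c, d)|rewrite /gcomposable/= grngM].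
by rewrite gmulA.
Qed.

Lemma smulA : associative smul.
Proof.
move=> a b c; elim/steinberg_ind: a => [|k B bB a IHa].
  by rewrite !smul0l.
rewrite !smul_lin_l IHa; congr (_ *: _ + _).
elim/steinberg_ind: b {IHa} => [|l C bC b IHb].
  by rewrite !(smul0l, smul0r).
rewrite !(smul_lin_l, smul_lin_r) IHb; congr (_ *: _ + _).
elim/steinberg_ind: c {IHb} => [|m D bD c IHc]; first by rewrite !smul0r.
rewrite !smul_lin_r IHc !smul_indic; congr (_ *: _ + _).
by apply: val_inj; rewrite /= gprodA.
Qed.

HB.instance Definition _ := Lmodule_isNonUnitalAlgebra.Build R steinberg
  smulA smulDl smulDr smulZl smulZr.

(* U is compact and open in the subspace topology of G^(0). *)
Definition diagonal_subalgebra : set steinberg :=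
  generated_subalgebra [set a : steinberg | exists U : set (@gunits G),
    [/\ compact U, open U & (a : G -> R^o) = \1_(set_val @` U)]].

End SteinbergAlgebra.

Arguments diagonal_subalgebra : clear implicits.

Section SteinbergStar.
Variables (R : involutiveRingType) (G : ampleGroupoidType).
Local Notation A := (steinberg R G).
Implicit Types (f : G -> R^o) (a b : A).

Definition involution f : G -> R^o := fun x => conjr (f (ginv x)).

Lemma involution_lin (k : R) f g :
  involution (k *: f + g) = conjr k *: involution f + involution g.
Proof.
apply/funext => x; change (conjr (k * f (ginv x) + g (ginv x)) =
  conjr k * conjr (f (ginv x)) + conjr (g (ginv x))).
by rewrite conjrD conjrM.
Qed.

Lemma involution0 : involution 0 = 0.
Proof. by apply/funext => x; rewrite /involution conjr0. Qed.

Lemma involution_indic B :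
  involution \1_B = \1_(@ginv G @^-1` B) :> (G -> R^o).
Proof.
apply/funext => x; rewrite /involution !indicE.
rewrite (_ : (x \in _) = (ginv x \in B)); last by apply/idP/idP; rewrite !inE.
by case: (_ \in _); rewrite ?conjr1 ?conjr0.
Qed.

Lemma steinberg_span_involution f :
  steinberg_span f -> steinberg_span (involution f).
Proof.
elim/steinberg_span_ind => [|k B g bB sg IHg].
  by rewrite involution0; exact: lspan0.
rewrite involution_lin involution_indic; apply: steinberg_span_lin => //.
by apply: steinberg_span_indic; exact: ginv_bisection.
Qed.

Definition sstar a : A :=
  Steinberg (steinberg_subproof (steinberg_span_involution (steinbergP a))).

Lemma sstar_lin (k : R) a b : sstar (k *: a + b) = conjr k *: sstar a + sstar b.
Proof. by apply: val_inj; exact: involution_lin. Qed.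

Lemma sstar0 : sstar 0 = 0.
Proof. by apply: val_inj; exact: involution0. Qed.

Lemma sstarD : {morph sstar : a b / a + b}.
Proof. by move=> a b; have := sstar_lin 1 a b; rewrite conjr1 !scale1r. Qed.

Lemma sstarZ (k : R) a : sstar (k *: a) = conjr k *: sstar a.
Proof. by have := sstar_lin k a 0; rewrite sstar0 !addr0. Qed.

Lemma sstarK : involutive sstar.
Proof.
move=> a; apply: val_inj; apply/funext => x /=.
by rewrite /involution ginvK conjrK.
Qed.

Lemma gprodV (B C : set G) :
  @ginv G @^-1` gprod B C = gprod (@ginv G @^-1` C) (@ginv G @^-1` B).
Proof.
rewrite eqEsubset; split=> [x [[b c] [[/= Bb Cc] /= bc] bcx]|].
  exists (ginv c, ginv b); last by rewrite /= -ginvM// bcx ginvK.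
  by split; [split; rewrite /= ginvK|rewrite /gcomposable/= gsrcV grngV].
move=> _ [[c b] [[/= Cc Bb] /= cb] <-].
exists (ginv b, ginv c); last by rewrite /= -ginvM.
by split=> //; rewrite /gcomposable/= gsrcV grngV.
Qed.

Lemma sstarM a b : sstar (amul a b) = amul (sstar b) (sstar a).
Proof.
rewrite -[amul a b]/(smul a b) -[RHS]/(smul _ _).
elim/steinberg_ind: a => [|k B bB a IHa].
  by rewrite sstar0 smul0l smul0r sstar0.
rewrite smul_lin_l !sstar_lin smul_lin_r IHa; congr (_ *: _ + _).
elim/steinberg_ind: b {IHa} => [|l C bC b IHb].
  by rewrite sstar0 smul0l smul0r sstar0.
rewrite smul_lin_r !sstar_lin smul_lin_l IHb; congr (_ *: _ + _).
apply: val_inj; rewrite /= convolution_indic// !involution_indic.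
by rewrite convolution_indic ?gprodV//; exact: ginv_bisection.
Qed.

HB.instance Definition _ := NonUnitalAlgebra_isStar.Build R A
  sstarD sstarZ sstarM sstarK.

End SteinbergStar.

(* Main.v *)
(* The isomorphism sends a (x) b to the function (x, y) |-> a x * b y. It is
   onto because ample groupoids have a base of compact open bisections: a
   compact open W in G x H is a finite union of rectangles B x C, and the
   indicator of a union is 1_V + 1_(B x C) - 1_(B x C) 1_V, where multiplying
   by 1_(B x C) acts on tensors through restriction of both factors. It is
   injective because a tensor is a sum of 1_B (x) b which, by splitting G along
   each B (clopen, as G is Hausdorff), can be taken with disjoint B's; the
   b's are then read off from the values of the image. Finally, G^(0) is clopen
   and D_R(G) consists of the elements of A_R(G) supported on G^(0), so that
   restricting a preimage tensor to G^(0) x H^(0) matches the diagonals. *)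
Require Import Defs.
From HB Require Import structures.
From mathcomp Require Import all_boot all_order all_algebra.
From mathcomp Require Import all_classical topology numfun.

Set Implicit Arguments.
Unset Strict Implicit.
Unset Printing Implicit Defensive.

Import GRing.Theory.

Local Open Scope classical_set_scope.
Local Open Scope ring_scope.

(** * Topology *)

(** Compactness serves here as an induction principle. If [P K] failed, the sets [S] with
    [P (K \ S)] would form a proper filter containing [K]. A cluster point of it in [K] has a
    neighbourhood [U] with [P U], so the complement of [U] belongs to the filter and yet has to meet
    [U]. *)
Lemma compact_set_ind (X : topologicalType) (K : set X) (P : set X -> Prop) :
  compact K -> P set0 -> (forall A B, P A -> P B -> P (A `|` B)) ->
  (forall A B, A `<=` B -> P B -> P A) ->
  (forall x, K x -> exists2 U, nbhs x U & P U) -> P K.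
Proof.
move=> cK P0 PU PS Pl; apply: contrapT => nPK.
pose F : set_system X := [set S | P (K `\` S)].
have FF : ProperFilter F.
  apply: Build_ProperFilter_ex => [S PKS|].
    by apply: contrapT => /nonemptyPn S0; apply: nPK; rewrite -(setD0 K) -S0.
  split; rewrite /F /=.
  - by rewrite setDT.
  - by move=> A B; rewrite /= setDIr; exact: PU.
  - by move=> A B AB; apply: PS; exact: setDS.
have [|x [Kx cx]] := cK F FF; first by rewrite /F /= setDv.
have [U xU PnU] := Pl x Kx.
have [|y [nUy Uy]] := cx (~` U) U _ xU; last exact: nUy.
by apply: PS PnU; rewrite setDE setCK; exact: subIsetr.
Qed.

(** * Compact open neighbourhoods in totally disconnected spaces *)

Section ZeroDimensional.
Variable X : topologicalType.
Hypothesis hX : hausdorff_space X.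
Hypothesis lX : locally_compact [set: X].

Lemma locally_compact_nbhs (x : X) : exists2 V, nbhs x V & compact V.
Proof.
have [V nV [cV _]] := @lX x I; exists V => //.
by move: nV; rewrite /within/=; apply: filterS => y; apply.
Qed.

(** By regularity each point of [A] has a neighbourhood whose closure misses [B]. Finitely many of
    them cover [A], and closure commutes with finite unions. *)
Lemma separate_compact_closed (A B : set X) :
  compact A -> closed B -> A `&` B = set0 ->
  exists2 U, open U & A `<=` U /\ closure U `&` B = set0.
Proof.
move=> cA cB AB; pose P S := exists2 U : set X, open U &
  S `&` A `<=` U /\ closure U `&` B = set0.
suff : P A by rewrite /P setIid.
apply: (compact_set_ind cA).
- by exists set0; [exact: open0|rewrite set0I closure0 set0I; split].
- move=> S T [U oU [SU UB]] [V oV [TV VB]]; exists (U `|` V).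
    exact: openU.
  split; last by rewrite closureU setIUl UB VB setU0.
  by rewrite setIUl; exact: setUSS.
- move=> S T ST [U oU [TU UB]]; exists U => //; split=> //.
  by apply: subset_trans TU; exact: setSI.
- move=> x Ax; have [V xV cV] := locally_compact_nbhs x.
  have /(compact_regular hX cV xV)[W xW WB] : nbhs x (~` B).
    apply: open_nbhs_nbhs; split; first exact: closed_openC.
    by move=> Bx; have : (A `&` B) x by []; rewrite AB.
  exists W° ; first exact: nbhs_interior.
  exists W°; first exact: open_interior.
  split; first exact: subIsetl.
  rewrite -subset0 => y [Wy By]; apply: WB By.
  by move: Wy; apply: closureS; exact: interior_subset.
Qed.

(* The intersection Q of the relatively clopen subsets of a compact V containing
   x is connected, hence equal to {x}; by compactness one of these subsets lies
   in the interiors of V and O. *)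
Lemma compact_open_nbhs (x : X) (O : set X) :
  totally_disconnected [set: X] -> nbhs x O ->
  exists2 K, [/\ compact K, open K & K x] & K `<=` O.
Proof.
move=> tX xO; have [V xV cV] := locally_compact_nbhs x.
have Vx : V x by exact: nbhs_singleton.
have clV : closed V by exact: compact_closed.
pose F : set (set X) :=
  [set C | [/\ C x, C `<=` V, closed C & closed (V `\` C)]].
have FV : F V by split=> //; rewrite setDv; exact: closed0.
have FI C D : F C -> F D -> F (C `&` D).
  move=> [Cx CV cC cVC] [Dx DV cD cVD]; split=> //.
  - by move=> y [/CV].
  - exact: closedI.
  - by rewrite setDIr; exact: closedU.
pose Q := \bigcap_(C in F) C.
have cQ : closed Q by apply: closed_bigI => C [].
have QV : Q `<=` V by move=> y; apply.
(* Since [F] is stable under intersection, the sets missed by some member of [F] are stable under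
   union. Points of [V \ W] lie outside [Q], so each has a neighbourhood of this kind, and
   compactness extends this to all of [V \ W]. *)
have small W : open W -> Q `<=` W -> exists2 C, F C & C `<=` W.
  move=> oW QW; suff [C FC CW] : exists2 C, F C & C `&` (V `\` W) = set0.
    exists C => // y Cy; apply: contrapT => nWy.
    have : (C `&` (V `\` W)) y.
      by split=> //; split=> //; have [_ CV _ _] := FC; exact: CV.
    by rewrite CW.
  apply: (@compact_set_ind _ _ (fun S => exists2 C, F C & C `&` S = set0)).
  - by apply: compact_closedI => //; exact: open_closedC.
  - by exists V => //; rewrite setI0.
  - move=> S T [C FC CS] [D FD DT]; exists (C `&` D); first exact: FI.
    by rewrite setIUr setIAC CS set0I -setIA DT setI0 setU0.
  - move=> S T ST [C FC CT]; exists C => //.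
    by rewrite -subset0 -CT; exact: setIS.
  - move=> y [Vy nWy].
    have [C [FC nCy]] : exists C, F C /\ ~ C y.
      apply: contrapT => /forallNP nC; apply/nWy/QW => C FC.
      by apply: contrapT => nCy; apply: (nC C).
    exists (~` C); last by exists C => //; rewrite setICr.
    by apply: open_nbhs_nbhs; split=> //; apply: closed_openC; case: FC.
(* Separate [A] from [B] by [U] and take [C] in [F] that avoids the boundary of [U]. Then [C] meets
   [U] and its closure in the same set, so [C] cut down to [U] is again in [F]. Hence [Q] lies in
   [U], which misses [B]. *)
have part A B : closed A -> closed B -> A `&` B = set0 -> Q = A `|` B ->
    A x -> B = set0.
  move=> cA cB AB QAB Ax.
  have AV : A `<=` V by move=> y Ay; apply: QV; rewrite QAB; left.
  have [|U oU [AU UB]] := @separate_compact_closed A B _ cB AB.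
    exact: (subclosed_compact cA cV).
  have [||C FC CU] := small (U `|` ~` closure U).
  - by apply: openU => //; apply: closed_openC; exact: closed_closure.
  - rewrite QAB => y [/AU|By]; [by left|right => /= Uy].
    by have : (closure U `&` B) y by []; rewrite UB.
  have FCU : F (C `&` U).
    case: FC => Cx CV cC cVC; split.
    - by split=> //; exact: AU.
    - by move=> y [/CV].
    - have -> : C `&` U = C `&` closure U.
        rewrite eqEsubset; split=> y [Cy Uy]; split=> //.
          exact: subset_closure.
        by have [] := CU _ Cy.
      by apply: closedI => //; exact: closed_closure.
    - rewrite setDIr; apply: closedU => //.
      by apply: closedI => //; exact: open_closedC.
  rewrite -subset0 -UB => y By; split=> //; apply: subset_closure.
  by have [] : (C `&` U) y by have : Q y by [rewrite QAB; right]; apply.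
have Qx : Q x by move=> C [].
have conQ : connected Q.
  move=> B [b Bb] [C oC BC] [D cD BD].
  have cB : closed B by rewrite BD; exact: closedI.
  have cQB : closed (Q `\` B).
    suff -> : Q `\` B = Q `&` ~` C by apply: closedI => //; exact: open_closedC.
    by rewrite BC setDIr setDv set0U.
  have BQ : B `<=` Q by rewrite BC; exact: subIsetl.
  have [Bx|nBx] := pselect (B x).
    apply/esym; have QBE : Q = B `|` (Q `\` B) by rewrite setDUK.
    by rewrite {1}QBE (part _ _ cB cQB _ QBE Bx) ?setU0 // setDIK.
  have : B = set0.
    apply: (part _ _ cQB cB) => //.
    - by rewrite setIC setDIK.
    - by rewrite setUC setDUK.
  by move=> B0; move: Bb; rewrite B0.
have QE : Q `<=` [set x].
  by rewrite -(tX x I); exact: connected_component_max.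
have [||C [Cx CV cC cVC] CO] := small (V° `&` O°).
- by apply: openI; exact: open_interior.
- by move=> y /QE ->; split.
exists C; last by move=> y /CO[_ /interior_subset].
split=> //; first exact: subclosed_compact cV CV.
(* [C] is open because it lies in the interior of [V] and its complement in [V] is closed. *)
suff -> : C = V° `&` ~` (V `\` C).
  by apply: openI; [exact: open_interior|exact: closed_openC].
rewrite eqEsubset; split=> y.
  by move=> Cy; split; [have [] := CO _ Cy|move=> []].
by move=> [/interior_subset Vy] nVC; apply: contrapT => nCy; apply: nVC.
Qed.

End ZeroDimensional.

Lemma open_setX (X Y : topologicalType) (A : set X) (B : set Y) :
  open A -> open B -> open (A `*` B).
Proof.
move=> oA oB; rewrite openE => -[a b] [/= Aa Bb]; exists (A, B) => //.
by split; exact: open_nbhs_nbhs.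
Qed.

Lemma clopen_setX (X Y : topologicalType) (A : set X) (B : set Y) :
  clopen A -> clopen B -> clopen (A `*` B).
Proof.
move=> [oA cA] [oB cB]; split; first exact: open_setX.
suff -> : A `*` B = ~` ((~` A) `*` setT `|` setT `*` (~` B)).
  apply: open_closedC; apply: openU; apply: open_setX => //;
    solve [exact: openT|exact: closed_openC].
rewrite eqEsubset; split=> -[a b] /=.
  by move=> [Aa Bb] [[]|[]].
by move=> nAB; split; apply: contrapT => n; apply: nAB; [left|right].
Qed.

Lemma hausdorff_prod (X Y : topologicalType) :
  hausdorff_space X -> hausdorff_space Y -> hausdorff_space (X * Y)%type.
Proof.
move=> hX hY; apply: continuous_hausdorff => -[x y] [x' y'] sep.
congr (_, _).
  exact: (sep _ fst hX (fun p => @cvg_fst _ _ _ _ _)).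
exact: (sep _ snd hY (fun p => @cvg_snd _ _ _ _ _)).
Qed.

(** * Compact open bisections *)

Section AmpleTopology.
Variable G : ampleGroupoidType.

(** A local inverse [g] of the source transports a small compact open set of units back to [G].
    Injectivity of the range is obtained from a neighbourhood [U'] of the inverse of [x] on which
    the source is injective, because the range of an arrow is the source of its inverse. *)
Lemma bisection_base (x : G) (O : set G) : nbhs x O ->
  exists2 B, @compact_open_bisections G B & B x /\ B `<=` O.
Proof.
move=> xO; have [U [g [[oU Ux ofU] [cf cg fK]]]] :=
  @local_homeomorphism_gsrc G x.
have [_ /(_ (ginv x)) [U' [oU' Ux' U'I _]]] :=
  (local_homeomorphismP _).1 (@local_homeomorphism_gsrc G).
pose N := U `&` O° `&` @ginv G @^-1` U'.
have oN : open N.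
  apply: openI; first by apply: openI => //; exact: open_interior.
  by move: (@continuous_ginv G) => /continuousP; apply.
have Nx : N x by split.
have := @open_nbhs_nbhs _ (gsrc0 x) (@gsrc0 G @` N).
case/(_ (conj (open_gsrc0 oN) (imageP _ Nx)))/(compact_open_nbhs
  (@hausdorff_gunits G) (@locally_compact_gunits G)
  (@totally_disconnected_gunits G)) => K [cK oK Kx] KN.
exists (N `&` @gsrc0 G @^-1` K); last first.
  by split=> // y [[[_ /interior_subset]]].
have NU : N `<=` U by move=> y [[]].
split.
(* Compactness: over [K] the set is the image of [K] under the local section [g]. *)
- have -> : N `&` @gsrc0 G @^-1` K = g @` K.
    rewrite eqEsubset; split=> [y [Ny Ky]|_ [k Kk <-]].
      by exists (gsrc0 y) => //; rewrite fK ?inE//; exact: NU.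
    have [n Nn nk] := KN _ Kk.
    by rewrite -nk fK ?inE; [split=> //=; rewrite nk|exact: NU].
  apply: continuous_compact => //; apply: continuous_subspaceW cg.
  by move=> k /KN[n /NU Un <-]; exists n.
- by apply: openI => //; move: (@continuous_gsrc0 G) => /continuousP; apply.
- move=> a b /set_mem[Na _] /set_mem[Nb _] e.
  have e0 : gsrc0 a = gsrc0 b by exact: eq_sig_hprop.
  by rewrite -(fK a) ?inE ?e0 ?fK ?inE//; exact: NU.
- move=> a b /set_mem[[_ Na] _] /set_mem[[_ Nb] _] e.
  rewrite -[a]ginvK -[b]ginvK; congr ginv; apply: U'I; rewrite ?inE//.
  by apply: eq_sig_hprop => //=; rewrite !gsrcV.
Qed.

Lemma bisectionI_clopen (B E : set G) : compact_open_bisections B ->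
  clopen E -> compact_open_bisections (B `&` E).
Proof.
move=> [cB oB siB riB] [oE cE]; split.
- exact: compact_closedI.
- exact: openI.
- by move=> x y /set_mem[Bx _] /set_mem[By _]; apply: siB; rewrite inE.
- by move=> x y /set_mem[Bx _] /set_mem[By _]; apply: riB; rewrite inE.
Qed.

Hypothesis hG : hausdorff_space G.

Lemma bisection_clopen (B : set G) : compact_open_bisections B -> clopen B.
Proof. by move=> [cB oB _ _]; split=> //; exact: compact_closed. Qed.

(** For closedness, separate a non-unit [x] from its source by disjoint [A] and [B]. Near [x],
    arrows lie in [A] and have their source in [B], so none of them equals its own source. *)
Lemma clopen_gunits : clopen (@gunits G).
Proof.
split; first exact: open_gunits.
rewrite -openC openE => x ux.
move: hG; rewrite open_hausdorff => /(_ x (gsrc x)) [|[A B] /=].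
  by apply/eqP => xE; apply: ux; exists x.
rewrite !inE => -[Ax Bx] [oA oB AB]; rewrite /interior.
have : nbhs x (A `&` @gsrc G @^-1` B).
  apply: filterI; first exact: open_nbhs_nbhs.
  by apply: continuous_gsrc; exact: open_nbhs_nbhs.
apply: filterS => y [Ay By] /gunitsP[sy _ _].
by have : (A `&` B) y; [split=> //; rewrite -sy|rewrite AB].
Qed.

End AmpleTopology.

(** * Rectangles of bisections in the product groupoid *)

Section ProductBisections.
Variables G H : ampleGroupoidType.
Local Notation GH := (G * H)%type.

Lemma bisection_setX (B : set G) (C : set H) : compact_open_bisections B ->
  compact_open_bisections C -> @compact_open_bisections GH (B `*` C).
Proof.
move=> [cB oB siB riB] [cC oC siC riC]; split.
- exact: compact_setX.
- exact: open_setX.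
- move=> [a b] [a' b'] /set_mem[/= Ba Cb] /set_mem[/= Ba' Cb'] [ea eb].
  by congr (_, _); [apply: siB|apply: siC]; rewrite ?inE.
- move=> [a b] [a' b'] /set_mem[/= Ba Cb] /set_mem[/= Ba' Cb'] [ea eb].
  by congr (_, _); [apply: riB|apply: riC]; rewrite ?inE.
Qed.

Lemma gprod_setX (B B' : set G) (C C' : set H) :
  @gprod GH (B `*` C) (B' `*` C') = gprod B B' `*` gprod C C'.
Proof.
rewrite eqEsubset; split.
  move=> _ [[[a b] [a' b']] [[[/= Ba Cb] [/= Ba' Cb']] [/= ea eb]] <-].
  by split; [exists (a, a')|exists (b, b')].
move=> [_ _] [/= [[a a'] [[/= Ba Ba'] ea] <-] [[b b'] [[/= Cb Cb'] eb] <-]].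
exists ((a, b), (a', b')) => //; split=> //.
by rewrite /gcomposable/= /gsrc/= /grng/= /prod_gsrc/= ea eb.
Qed.

End ProductBisections.

(** * Restriction to clopen sets and the diagonal *)

Section Restriction.
Variables (R : comPzRingType) (G : ampleGroupoidType).
Local Notation A := (steinberg R G).
Implicit Types (a b : A) (B E : set G) (f g : G -> R^o).

Lemma steinbergE k a b x : (k *: a + b) x = k * a x + b x.
Proof. by []. Qed.

Lemma steinbergDE a b x : (a + b) x = a x + b x.
Proof. by []. Qed.

Lemma steinberg_ext a b : (forall x, a x = b x) -> a = b.
Proof. by move=> ab; apply/val_inj/funext. Qed.

Lemma sindicE B (bB : compact_open_bisections B) x :
  sindic R bB x = (x \in B)%:R.
Proof. by rewrite /= indicE. Qed.

Definition frestr E f : G -> R^o := fun x => (x \in E)%:R * f x.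

Lemma frestr_lin E k f g : frestr E (k *: f + g) = k *: frestr E f + frestr E g.
Proof.
apply/funext => x; change ((x \in E)%:R * (k * f x + g x) =
  k * ((x \in E)%:R * f x) + (x \in E)%:R * g x).
by rewrite mulrDr mulrCA.
Qed.

(** Linearity reduces this to an indicator, and cutting a compact open bisection by [E] leaves one:
    closedness of [E] preserves compactness, openness of [E] preserves openness. *)
Lemma steinberg_span_restr E f :
  clopen E -> steinberg_span f -> steinberg_span (frestr E f).
Proof.
move=> cE; elim/steinberg_span_ind => [|k B g bB _ IHg].
  rewrite (_ : frestr E 0 = 0); first exact: lspan0.
  by apply/funext => x; rewrite /frestr mulr0.
rewrite frestr_lin; apply: steinberg_span_lin => //.
rewrite (_ : frestr E \1_B = \1_(B `&` E)).
  by apply: steinberg_span_indic; exact: bisectionI_clopen.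
by apply/funext => x; rewrite /frestr !indicE in_setI andbC -mulnb natrM.
Qed.

Definition srestr E (cE : clopen E) a : A :=
  Steinberg (steinberg_subproof (steinberg_span_restr cE (steinbergP a))).

Lemma srestrE E (cE : clopen E) a x : srestr cE a x = (x \in E)%:R * a x.
Proof. by []. Qed.

Lemma srestrD E (cE : clopen E) : {morph srestr cE : a b / a + b}.
Proof. by move=> a b; apply: steinberg_ext => x; rewrite srestrE mulrDr. Qed.

Lemma srestrZ E (cE : clopen E) k a : srestr cE (k *: a) = k *: srestr cE a.
Proof. by apply: steinberg_ext => x; rewrite srestrE mulrCA. Qed.

Lemma srestr0 E (cE : clopen E) : srestr cE 0 = 0.
Proof. by apply: steinberg_ext => x; rewrite srestrE mulr0. Qed.

Lemma srestr_id E (cE : clopen E) a :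
  (forall x, ~ E x -> a x = 0) -> srestr cE a = a.
Proof.
move=> a0; apply: steinberg_ext => x; rewrite srestrE.
have [_|/negP Ex] := boolP (x \in E); first by rewrite mul1r.
by rewrite mul0r a0// => /mem_set.
Qed.

Lemma srestr_eq0 E (cE : clopen E) a :
  (forall x, E x -> a x = 0) -> srestr cE a = 0.
Proof.
move=> a0; apply: steinberg_ext => x; rewrite srestrE.
have [/set_mem Ex|_] := boolP (x \in E); first by rewrite a0// mulr0.
by rewrite mul0r.
Qed.

Lemma srestr_sindic E (cE : clopen E) B (bB : compact_open_bisections B) :
  srestr cE (sindic R bB) = sindic R (bisectionI_clopen bB cE).
Proof.
apply: steinberg_ext => x; rewrite srestrE !sindicE in_setI andbC.
by rewrite -mulnb natrM.
Qed.

End Restriction.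

Section Diagonal.
Variables (R : comPzRingType) (G : ampleGroupoidType).
Hypothesis hG : hausdorff_space G.

(** Functions vanishing off the units form a subalgebra: in the convolution at a non-unit [x], a
    term at a unit [y] has first factor evaluated at [x] itself. Conversely, restricting the
    indicator of a bisection to the units gives a generator. *)
Lemma diagonal_subalgebraP (a : steinberg R G) :
  diagonal_subalgebra R G a <-> forall x, ~ gunits x -> a x = 0.
Proof.
split=> [|a0].
  move=> /(_ [set b : steinberg R G | forall x, ~ gunits x -> b x = 0]).
  apply; split; last first.
    move=> b [U [_ _ bU]] x ux; rewrite bU indicE memNset// => -[u _ uE].
    by apply: ux; rewrite -uE; exact: set_mem (valP u).
  split=> [//|b c b0 c0 x ux|k b b0 x ux|b c b0 c0 x ux] /=.
  - by rewrite -[LHS]/(b x + c x) b0// c0// addr0.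
  - by rewrite -[LHS]/(k * b x) b0// mulr0.
  - rewrite -[LHS]/(convolution b c x) /convolution fsbig1// => y /= yx.
    have [/gunitsP[sy _ yV]|uy] := pselect (gunits y); last first.
      by rewrite c0// mulr0.
    by rewrite yV -sy yx gmul_src b0// mul0r.
(* The support condition on [a] need not pass to the summands of [a], so [a] is replaced by its
   restriction before the induction. *)
rewrite -(srestr_id (clopen_gunits hG) a0) => S [[S0 SD SZ _] gS].
elim/steinberg_ind: a {a0} => [|k B bB a IHa].
  by rewrite srestr0.
rewrite srestrD srestrZ; apply: SD => //; apply: SZ; apply: gS.
have [cU oU _ _] := bisectionI_clopen bB (clopen_gunits hG).
(* The source is the identity on units, so this image is the set [B] cut down to the units, seen
   inside the unit space. *)
exists (@gsrc0 G @` (B `&` @gunits G)); split.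
- apply: continuous_compact => //; apply: continuous_subspaceT.
  exact: continuous_gsrc0.
- exact: open_gsrc0.
- rewrite (_ : set_val @` _ = B `&` @gunits G).
    by rewrite srestr_sindic.
  rewrite image_comp (_ : set_val \o _ = gsrc) //.
  rewrite eqEsubset; split=> [_ [y [By uy] <-]|x [Bx ux]].
    by have [-> _ _] := gunitsP uy.
  by exists x => //; have [-> _ _] := gunitsP ux.
Qed.

End Diagonal.

(** * The comparison map *)

Section ExteriorProduct.
Variables (R : comPzRingType) (G H : ampleGroupoidType).
Local Notation GH := (G * H)%type.
Local Notation A := (steinberg R G).
Local Notation B := (steinberg R H).
Implicit Types (a : A) (b : B).

Definition fexterior (f : G -> R^o) (g : H -> R^o) : GH -> R^o :=
  fun p => f p.1 * g p.2.

Lemma fexterior_indic (U : set G) (V : set H) :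
  fexterior \1_U \1_V = \1_(U `*` V).
Proof.
apply/funext => -[x y]; rewrite /fexterior !indicE /= -natrM mulnb.
by rewrite in_setX.
Qed.

(** Bilinearity reduces this to two indicators, whose product is the indicator of a rectangle, a
    bisection by [bisection_setX]. *)
Lemma steinberg_span_exterior a b : steinberg_span (fexterior a b).
Proof.
elim/steinberg_ind: a => [|k U bU a IHa].
  rewrite (_ : fexterior _ _ = 0); first exact: lspan0.
  by apply/funext => p; rewrite /fexterior /= mul0r.
rewrite (_ : fexterior _ _ = k *: fexterior (sindic R bU) b + fexterior a b).
  apply: steinberg_span_lin => // {a IHa}.
  elim/steinberg_ind: b => [|l V bV b IHb].
    rewrite (_ : fexterior _ _ = 0); first exact: lspan0.
    by apply/funext => p; rewrite /fexterior /= mulr0.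
  rewrite (_ : fexterior _ _ = l *: fexterior (sindic R bU) (sindic R bV) +
    fexterior (sindic R bU) b).
    apply: steinberg_span_lin => //; rewrite fexterior_indic.
    by apply: steinberg_span_indic; exact: bisection_setX.
  apply/funext => p; rewrite /fexterior steinbergE mulrDr mulrCA.
  by [].
apply/funext => p; rewrite /fexterior steinbergE mulrDl -mulrA.
by [].
Qed.

Definition exterior a b : steinberg R GH :=
  Steinberg (steinberg_subproof (steinberg_span_exterior a b)).

Lemma exteriorE a b p : exterior a b p = a p.1 * b p.2. Proof. by []. Qed.

Lemma exterior_sindic (U : set G) (V : set H) (bU : compact_open_bisections U)
    (bV : compact_open_bisections V) :
  exterior (sindic R bU) (sindic R bV) = sindic R (bisection_setX bU bV).
Proof. by apply: val_inj; exact: fexterior_indic. Qed.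

Lemma exterior_linl k a a' b :
  exterior (k *: a + a') b = k *: exterior a b + exterior a' b.
Proof.
by apply: steinberg_ext => p; rewrite exteriorE !steinbergE mulrDl -mulrA.
Qed.

Lemma exterior_linr k a b b' :
  exterior a (k *: b + b') = k *: exterior a b + exterior a b'.
Proof.
by apply: steinberg_ext => p; rewrite exteriorE !steinbergE mulrDr mulrCA.
Qed.

Lemma exterior0l b : exterior 0 b = 0.
Proof. by apply: steinberg_ext => p; rewrite exteriorE mul0r. Qed.

Lemma exterior0r a : exterior a 0 = 0.
Proof. by apply: steinberg_ext => p; rewrite exteriorE mulr0. Qed.

Lemma exterior_bal : balanced exterior.
Proof.
split=> [a a' b|a b b'|k a b].
- by have := exterior_linl 1 a a' b; rewrite !scale1r.
- by have := exterior_linr 1 a b b'; rewrite !scale1r.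
- apply: steinberg_ext => p.
  change (k * a p.1 * b p.2 = a p.1 * (k * b p.2)).
  by rewrite mulrCA mulrA.
Qed.

(** Both sides are linear in each of the four arguments. On indicators, convolution is the product
    of bisections, which is computed factorwise on rectangles. *)
Lemma exteriorM a a' b b' : exterior (smul a a') (smul b b') =
  smul (exterior a b) (exterior a' b').
Proof.
elim/steinberg_ind: a => [|k U bU a IHa].
  by rewrite smul0l !exterior0l smul0l.
rewrite smul_lin_l !exterior_linl smul_lin_l IHa; congr (_ *: _ + _).
elim/steinberg_ind: a' {a IHa} => [|k' U' bU' a' IHa'].
  by rewrite smul0r !exterior0l smul0r.
rewrite smul_lin_r !exterior_linl smul_lin_r IHa'; congr (_ *: _ + _).
elim/steinberg_ind: b {a' IHa'} => [|l V bV b IHb].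
  by rewrite smul0l !exterior0r smul0l.
rewrite smul_lin_l !exterior_linr smul_lin_l IHb; congr (_ *: _ + _).
elim/steinberg_ind: b' {b IHb} => [|l' V' bV' b' IHb'].
  by rewrite smul0r !exterior0r smul0r.
rewrite smul_lin_r !exterior_linr smul_lin_r IHb'; congr (_ *: _ + _).
rewrite !smul_indic !exterior_sindic smul_indic.
by apply: val_inj; rewrite /= gprod_setX.
Qed.

Local Notation T := (tensor A B).

(** The isomorphism of the theorem. *)
Definition sext : T -> steinberg R GH := tlift exterior.

Lemma sext_tens a b : sext (tens a b) = exterior a b.
Proof. exact: (tlift_tens exterior_bal). Qed.

Lemma sextD : {morph sext : x y / x + y}.
Proof. exact: (tliftD exterior_bal). Qed.

Lemma sext0 : sext 0 = 0. Proof. exact: (tlift0 exterior_bal). Qed.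

Lemma sextZ k x : sext (k *: x) = k *: sext x.
Proof.
elim/tensor_ind: x => [|a b x IHx]; first by rewrite scaler0 sext0 scaler0.
rewrite scalerDr !sextD IHx scalerDr -tensZl !sext_tens.
by have := exterior_linl k a 0 b; rewrite exterior0l !addr0 => ->.
Qed.

Lemma sextM x y : sext (tmul x y) = smul (sext x) (sext y).
Proof.
elim/tensor_ind: x => [|a b x IHx]; first by rewrite tmul0l sext0 smul0l.
rewrite tmulDl !sextD smulDl IHx; congr (_ + _).
elim/tensor_ind: y {IHx} => [|a' b' y IHy].
  by rewrite tmul0r sext0 smul0r.
by rewrite tmulDr !sextD smulDr IHy tmul_tens !sext_tens exteriorM.
Qed.

End ExteriorProduct.

Section TensorZero.
Variables (R : comPzRingType) (A B : lmodType R).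

Lemma tens0l (b : B) : tens (0 : A) b = 0.
Proof. by rewrite -[in LHS](scale0r 0) tensZl scale0r. Qed.

Lemma tens0r (a : A) : tens a (0 : B) = 0.
Proof. by rewrite -[in LHS](scale0r 0) tensZr scale0r. Qed.

End TensorZero.

(** * Restriction of tensors to clopen rectangles *)

Section TensorRestriction.
Variables (R : comPzRingType) (G H : ampleGroupoidType).
Local Notation GH := (G * H)%type.
Local Notation A := (steinberg R G).
Local Notation B := (steinberg R H).
Local Notation T := (tensor A B).
Variables (E : set G) (F : set H) (cE : clopen E) (cF : clopen F).

Definition trestr : T -> T :=
  tlift (fun a b => tens (srestr cE a) (srestr cF b)).

Let bal : balanced (fun (a : A) (b : B) => tens (srestr cE a) (srestr cF b)).
Proof.
split=> [a a' b|a b b'|k a b].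
- by rewrite srestrD tensDl.
- by rewrite srestrD tensDr.
- by rewrite !srestrZ tensZl tensZr.
Qed.

Lemma trestr_tens a b : trestr (tens a b) = tens (srestr cE a) (srestr cF b).
Proof. exact: tlift_tens. Qed.

Lemma trestrD : {morph trestr : x y / x + y}. Proof. exact: tliftD. Qed.

Lemma trestr0 : trestr 0 = 0. Proof. exact: tlift0. Qed.

(** This lets functions on the product be cut down at the level of tensors. Injectivity,
    surjectivity and the treatment of the diagonal all rest on it. *)
Lemma sext_trestr x : sext (trestr x) = srestr (clopen_setX cE cF) (sext x).
Proof.
apply: steinberg_ext => p; rewrite srestrE.
elim/tensor_ind: x => [|a b x IHx].
  by rewrite trestr0 sext0 mulr0.
rewrite trestrD trestr_tens !sextD.
rewrite !steinbergDE IHx !sext_tens mulrDr; congr (_ + _).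
rewrite !exteriorE !srestrE mulrACA; congr (_ * _).
by rewrite -natrM mulnb -in_setX; case: (p).
Qed.

End TensorRestriction.

(** * Bijectivity *)

Section Injectivity.
Variables (R : comPzRingType) (G H : ampleGroupoidType).
Hypothesis hG : hausdorff_space G.
Local Notation A := (steinberg R G).
Local Notation B := (steinberg R H).
Local Notation T := (tensor A B).

Definition indicator_below (E : set G) (a : A) :=
  exists2 U : set G, compact_open_bisections U /\ U `<=` E &
    (a : G -> R^o) = \1_U.

(** The first components are indicators only through the [indicator_below] hypotheses that accompany
    [s]. *)
Definition indicator_sum (s : seq (A * B)) : T := \sum_(p <- s) tens p.1 p.2.

Let cT : clopen [set: H] := clopenT.

Definition restr_seq (E : set G) (cE : clopen E) (s : seq (A * B)) :=
  [seq (srestr cE p.1, p.2) | p <- s].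

Lemma srestrT (b : B) : srestr cT b = b.
Proof. by apply: srestr_id => x []. Qed.

Lemma trestr_sum (E : set G) (cE : clopen E) s :
  trestr cE cT (indicator_sum s) = indicator_sum (restr_seq cE s).
Proof.
rewrite /indicator_sum big_map; elim: s => [|p s IHs].
  by rewrite !big_nil trestr0.
by rewrite !big_cons trestrD trestr_tens IHs srestrT.
Qed.

Lemma trestr_split (E : set G) (cE : clopen E) (cE' : clopen (~` E)) (x : T) :
  x = trestr cE cT x + trestr cE' cT x.
Proof.
elim/tensor_ind: x => [|a b x IHx]; first by rewrite !trestr0 addr0.
rewrite !trestrD !trestr_tens !srestrT addrACA -IHx -tensDl.
congr (tens _ _ + _); apply: steinberg_ext => y.
rewrite steinbergDE !srestrE -mulrDl in_setC.
by case: (y \in E); rewrite ?addr0 ?add0r mul1r.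
Qed.

Lemma indicator_below_restr (D E : set G) (cE : clopen E) a :
  indicator_below D a -> indicator_below (D `&` E) (srestr cE a).
Proof.
move=> [U [bU UD] aU]; exists (U `&` E).
  by split; [exact: bisectionI_clopen|exact: setSI].
apply/funext => x; rewrite srestrE aU !indicE in_setI andbC.
by rewrite -mulnb natrM.
Qed.

Lemma all_indicator_restr (D D' E : set G) (cE : clopen E) s :
  D `&` E `<=` D' -> (forall p, p \in s -> indicator_below D p.1) ->
  forall p, p \in restr_seq cE s -> indicator_below D' p.1.
Proof.
move=> DD' sD _ /mapP[p /sD pD ->].
have [U [bU UDE] aU] := indicator_below_restr cE pD.
by exists U => //; split=> //; exact: subset_trans DD'.
Qed.

Lemma sext_trestr0 (E : set G) (cE : clopen E) (x : T) :
  sext x = 0 -> sext (trestr cE cT x) = 0.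
Proof. by move=> x0; rewrite sext_trestr x0 srestr0. Qed.

(* Splitting along the support of the first p.1, where both halves involve one
   summand less, reduces to a single elementary tensor. *)
Lemma sext_inj_below s (U : set G) (bU : compact_open_bisections U) b :
  (forall p, p \in s -> indicator_below U p.1) ->
  sext (tens (sindic R bU) b + indicator_sum s) = 0 ->
  tens (sindic R bU) b + indicator_sum s = 0.
Proof.
have [n] := ubnP (size s); elim: n => // n IHn in s U bU b *.
case: s => [|p s] /= sn sU e0.
  (* A single tensor remains. At a point [x] of [U] its image is the function [b] of the second
     variable, so [b] vanishes; if [U] is empty, the first factor vanishes. *)
  move: e0; rewrite /indicator_sum big_nil addr0 sext_tens => e0.
  have [U0|/set0P[x Ux]] := eqVneq U set0.
    rewrite (_ : sindic R bU = 0); first by rewrite tens0l.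
    by apply: steinberg_ext => x; rewrite sindicE U0 in_set0.
  rewrite (_ : b = 0); first by rewrite tens0r.
  apply: steinberg_ext => y.
  have : exterior (sindic R bU) b (x, y) = 0 by rewrite e0.
  by rewrite exteriorE sindicE mem_set// mul1r.
have [V [bV VU] pV] := sU p (mem_head _ _).
have cV := bisection_clopen hG bV.
have cV' : clopen (~` V) by exact: clopenC.
have bU' := bisectionI_clopen bU cV'.
have pE : p.1 = sindic R bV by apply: val_inj.
have sU' q : q \in s -> indicator_below U q.1.
  by move=> qs; apply: sU; rewrite inE qs orbT.
have rV : srestr cV (sindic R bU) = sindic R bV.
  rewrite srestr_sindic; apply: steinberg_ext => x; rewrite !sindicE.
  by congr (_ \in _)%:R; exact/setIidPr.
have rV' : srestr cV' (sindic R bU) = sindic R bU'.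
  by rewrite srestr_sindic; exact: val_inj.
have pV0 : srestr cV' (sindic R bV) = 0.
  by apply: srestr_eq0 => x nVx; rewrite sindicE memNset.
have pV1 : srestr cV (sindic R bV) = sindic R bV.
  by apply: srestr_id => x Vx; rewrite sindicE memNset.
(* Over [V] the leading tensor and [p] have the same first factor and merge into one tensor. Off [V]
   the term [p] disappears and the leading indicator shrinks. *)
have rE : trestr cV cT (tens (sindic R bU) b + indicator_sum (p :: s)) =
    tens (sindic R bV) (b + p.2) + indicator_sum (restr_seq cV s).
  rewrite trestrD trestr_tens trestr_sum /indicator_sum /= big_cons /=.
  by rewrite srestrT rV pE pV1 tensDr addrA.
have rE' : trestr cV' cT (tens (sindic R bU) b + indicator_sum (p :: s)) =
    tens (sindic R bU') b + indicator_sum (restr_seq cV' s).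
  rewrite trestrD trestr_tens trestr_sum /indicator_sum /= big_cons /=.
  by rewrite srestrT rV' pE pV0 tens0l add0r.
rewrite (trestr_split cV cV' (tens _ _ + _)) rE rE'.
move: (sext_trestr0 cV e0) (sext_trestr0 cV' e0); rewrite rE rE' => z z'.
rewrite (IHn _ _ _ _ _ _ z) ?size_map//; last first.
  by apply: all_indicator_restr sU'; exact: subIsetr.
rewrite (IHn _ _ _ _ _ _ z') ?size_map ?addr0//.
by apply: all_indicator_restr sU'; exact: subset_refl.
Qed.

(** The coefficients of the first factor are moved into the second, which leaves bare indicators on
    the left. *)
Lemma tensor_indicator_sum (x : T) : exists2 s,
  forall p, p \in s -> indicator_below setT p.1 & x = indicator_sum s.
Proof.
elim/tensor_ind: x => [|a b x [t tT ->]].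
  by exists [::]; rewrite /indicator_sum ?big_nil.
elim/steinberg_ind: a => [|k U bU a [s sT sE]].
  by exists t => //; rewrite tens0l add0r.
exists ((sindic R bU, k *: b) :: s) => [p|].
  by rewrite inE => /orP[/eqP ->|/sT//]; exists U.
by rewrite /indicator_sum big_cons tensDl tensZl tensZr -addrA sE.
Qed.

(** Induction on the number of summands, splitting along the support [V] of the first: over [V] the
    sum has the shape required by [sext_inj_below], and off [V] the first summand is gone. *)
Lemma sext_eq0 (x : T) : sext x = 0 -> x = 0.
Proof.
have [s sT ->] := tensor_indicator_sum x.
have [n] := ubnP (size s); elim: n => // n IHn in s sT *.
case: s sT => [|p s] sT /= sn e0; first by rewrite /indicator_sum big_nil.
have [V [bV _] pV] := sT p (mem_head _ _).
have cV := bisection_clopen hG bV.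
have cV' : clopen (~` V) by exact: clopenC.
have pE : p.1 = sindic R bV by apply: val_inj.
have sT' q : q \in s -> indicator_below setT q.1.
  by move=> qs; apply: sT; rewrite inE qs orbT.
have pV0 : srestr cV' (sindic R bV) = 0.
  by apply: srestr_eq0 => x0 nVx; rewrite sindicE memNset.
have pV1 : srestr cV (sindic R bV) = sindic R bV.
  by apply: srestr_id => x0 Vx; rewrite sindicE memNset.
have rE : trestr cV cT (indicator_sum (p :: s)) =
    tens (sindic R bV) p.2 + indicator_sum (restr_seq cV s).
  by rewrite trestr_sum /indicator_sum /= big_cons /= pE pV1.
have rE' : trestr cV' cT (indicator_sum (p :: s)) =
    indicator_sum (restr_seq cV' s).
  rewrite trestr_sum /indicator_sum /= big_cons /=.
  by rewrite pE pV0 tens0l add0r.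
rewrite (trestr_split cV cV' (indicator_sum _)) rE rE'.
move: (sext_trestr0 cV e0) (sext_trestr0 cV' e0); rewrite rE rE' => z z'.
rewrite (sext_inj_below _ z); last first.
  by apply: all_indicator_restr sT'; exact: subIsetr.
rewrite (IHn _ _ _ z') ?size_map ?addr0//.
by apply: all_indicator_restr sT'.
Qed.

Lemma sext_inj : injective (@sext R G H).
Proof.
move=> x y xy; apply/eqP; rewrite -subr_eq0; apply/eqP/sext_eq0.
by rewrite -scaleN1r sextD sextZ xy scaleN1r subrr.
Qed.

End Injectivity.

Section Surjectivity.
Variables (R : comPzRingType) (G H : ampleGroupoidType).
Hypotheses (hG : hausdorff_space G) (hH : hausdorff_space H).
Local Notation GH := (G * H)%type.
Local Notation T := (tensor (steinberg R G) (steinberg R H)).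

Lemma sext_sindic (W : set GH) (bW : compact_open_bisections W) :
  exists x : T, sext x = sindic R bW.
Proof.
have [cW oW _ _] := bW.
(* Quantifying over V makes P stable under unions, by chaining extensions. *)
pose P (S : set GH) := forall (V : set GH) (x : T), V `<=` W ->
  (sext x : GH -> R^o) = \1_V -> exists V' (y : T),
    [/\ V `|` (S `&` W) `<=` V', V' `<=` W & (sext y : GH -> R^o) = \1_V'].
suff PW : P W.
  (* Starting from the empty set and the zero tensor, the extension contains [W] and stays inside
     [W], so it is [W]. *)
  have [||V [x [WV VW xV]]] := PW set0 0; first by [].
    by rewrite sext0; apply/funext => p; rewrite indicE in_set0.
  exists x; apply: val_inj; rewrite /= xV; congr (\1_ _).
  by rewrite eqEsubset; split=> // p Wp; apply: WV; right.
apply: (compact_set_ind cW).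
- by move=> V x VW xV; exists V, x; rewrite set0I setU0; split.
- move=> S S' PS PS' V x VW xV.
  have [V1 [x1 [V1s V1W x1V]]] := PS V x VW xV.
  have [V2 [x2 [V2s V2W x2V]]] := PS' V1 x1 V1W x1V.
  exists V2, x2; split=> // p [Vp|[[Sp|Sp] Wp]].
  + by apply/V2s; left; apply/V1s; left.
  + by apply/V2s; left; apply/V1s; right.
  + by apply/V2s; right.
- move=> S S' SS' PS V x VW xV; have [V' [x' [V's V'W x'V]]] := PS V x VW xV.
  exists V', x'; split=> // p [Vp|[Sp Wp]]; apply: V's; [by left|right].
  by split=> //; exact: SS'.
move=> [u v] Wuv; have [[O O'] /= [uO vO']] := oW _ Wuv.
have [B bB [Bu BO]] := bisection_base uO.
have [C bC [Cv CO']] := bisection_base vO' => OW.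
have cB := bisection_clopen hG bB; have cC := bisection_clopen hH bC.
have BCW : B `*` C `<=` W by move=> [p q] [/BO Op /CO' Oq]; exact: OW.
exists (B `*` C).
  have [_ oBC _ _] := bisection_setX bB bC.
  by apply: open_nbhs_nbhs; split.
move=> V x VW xV; exists (V `|` B `*` C).
(* Inclusion-exclusion: the restricted tensor removes the part of [V] inside the rectangle, which
   would otherwise be counted twice. *)
exists ((-1) *: trestr cB cC x + (tens (sindic R bB) (sindic R bC) + x)).
split.
- by move=> p [Vp|[BCp _]]; [left|right].
- by move=> p [/VW|/BCW].
apply/funext => p; rewrite !sextD sextZ sext_trestr sext_tens exterior_sindic.
rewrite steinbergE steinbergDE srestrE sindicE xV !indicE in_setU.
case: (p \in V); case: (p \in _);
  rewrite /= ?mulr1 ?mulr0 ?addr0 ?add0r//.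
exact: addKr.
Qed.

Lemma sext_surj (f : steinberg R GH) : exists x : T, sext x = f.
Proof.
elim/steinberg_ind: f => [|k W bW f [x <-]]; first by exists 0; exact: sext0.
have [y <-] := sext_sindic bW.
by exists (k *: y + x); rewrite sextD sextZ.
Qed.

End Surjectivity.

(** * Compatibility with the involution and the diagonals *)

Section MainTheorem.
Variables (R : involutiveRingType) (G H : ampleGroupoidType).
Local Notation GH := (G * H)%type.
Local Notation T := (tensor (steinberg R G) (steinberg R H)).

Lemma exterior_star (a : steinberg R G) (b : steinberg R H) :
  exterior (star a) (star b) = star (exterior a b).
Proof. by apply: steinberg_ext => p; exact/esym/conjrM. Qed.

Lemma sext_star : {morph @sext R G H : x / star x}.
Proof.
move=> x; rewrite -[LHS]/(sext (tstar x)) -[RHS]/(sstar (sext x)).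
elim/tensor_ind: x => [|a b x IHx]; first by rewrite tstar0 sext0 sstar0.
by rewrite tstarD !sextD sstarD IHx tstar_tens !sext_tens exterior_star.
Qed.

Lemma sext_linear : linear (@sext R G H).
Proof. by move=> k x y; rewrite sextD sextZ. Qed.

Hypotheses (hG : hausdorff_space G) (hH : hausdorff_space H).

(** Both inclusions use the description of diagonals by supports. An arrow of the product that is
    not a unit has a non-unit coordinate, where one of the two factors vanishes. *)
Lemma sext_diagonal :
  @sext R G H @` lspan [set tens d d' | d in diagonal_subalgebra R G
                                      & d' in diagonal_subalgebra R H]
  = diagonal_subalgebra R GH.
Proof.
have hGH := hausdorff_prod hG hH.
rewrite eqEsubset; split=> [_ [t dt <-]|f /(diagonal_subalgebraP hGH) df].
  apply/(diagonal_subalgebraP hGH) => p pu.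
  elim/lspan_ind: dt => [|k _ x [d dd [d' dd' <-]] IHx].
    by rewrite sext0.
  rewrite sextD sextZ sext_tens steinbergE IHx addr0 exteriorE.
  have [u1|u1] := pselect (gunits p.1).
    have [u2|u2] := pselect (gunits p.2).
      by case: pu; rewrite gunits_prod.
    by rewrite ((diagonal_subalgebraP hH _).1 dd')// !mulr0.
  by rewrite ((diagonal_subalgebraP hG _).1 dd)// mul0r mulr0.
have [t tf] := sext_surj hG hH f.
pose cG := clopen_gunits hG; pose cH := clopen_gunits hH.
(* Restriction puts both factors of every elementary tensor in the diagonals, and leaves the image
   unchanged because [f] is supported on units. *)
exists (trestr cG cH t).
  elim/tensor_ind: t {tf} => [|a b y IHy].
    by rewrite trestr0; exact: lspan0.
  rewrite trestrD; apply: lspanD => //; apply: sub_lspan; rewrite trestr_tens.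
  exists (srestr cG a).
    apply/(diagonal_subalgebraP hG) => z uz.
    by rewrite srestrE memNset// mul0r.
  exists (srestr cH b) => //.
  apply/(diagonal_subalgebraP hH) => z uz.
  by rewrite srestrE memNset// mul0r.
rewrite sext_trestr tf; apply: srestr_id => p; rewrite -gunits_prod.
exact: df.
Qed.

End MainTheorem.

Theorem theorem4p3 (R : involutiveRingType) (G H : ampleGroupoidType)
    (hG : hausdorff_space G) (hH : hausdorff_space H) :
  exists sigma : tensor (steinberg R G) (steinberg R H) ->
                 steinberg R (G * H)%type,
    star_isomorphism sigma /\
    sigma @` lspan [set tens d d' | d in diagonal_subalgebra R G
                                  & d' in diagonal_subalgebra R H]
    = diagonal_subalgebra R (G * H)%type.
Proof.
exists (@sext R G H); split; last exact: sext_diagonal.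
split; [exact: sext_linear|exact: sextM|exact: sext_star|].
have [inv invK] := choice (@sext_surj R G H hG hH).
exists inv => // x; apply: (sext_inj hG); exact: invK.
Qed.
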